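(* Let $n\ge1$, $0<s<1$, $\lambda\in\mathbb{R}$, and let $$w\in C^{2s+\epsilon,s+\epsilon}_{x,\,t,\,{\rm loc}}(\Sigma_\lambda\times\mathbb{R})\cap\mathcal{L}(\mathbb{R}^n\times\mathbb{R})$$ for some $\epsilon>0$ be upper semi-continuous up to the boundary $T_\lambda$ and bounded from above in $\Sigma_\lambda\times\mathbb{R}$. Suppose that $$\begin{cases}(\partial_t-\Delta)^s w(x,t)\le 0 & \text{at the points of }\Sigma_\lambda\times\mathbb{R}\text{ where }w(x,t)>0,\\ w(x,t)=-w(x^\lambda,t) & \text{in }\Sigma_\lambda\times\mathbb{R}.\end{cases}$$ Then $w(x,t)\le 0$ in $\Sigma_\lambda\times\mathbb{R}$.
   Context: For $0<s<1$, the fully fractional heat operator is defined pointwise by $$(\partial_t-\Delta)^s u(x,t):=C_{n,s}\int_{-\infty}^{t}\int_{\mathbb{R}^n}\frac{u(x,t)-u(y,\tau)}{(t-\tau)^{\frac n2+1+s}}e^{-\frac{|x-y|^2}{4(t-\tau)}}\,dy\,d\tau,\qquad C_{n,s}=\frac{1}{(4\pi)^{n/2}|\Gamma(-s)|},$$ with the $y$-integral taken in the Cauchy principal value sense. The space $\mathcal{L}(\mathbb{R}^n\times\mathbb{R})$ consists of $u\in L^1_{\rm loc}(\mathbb{R}^n\times\mathbb{R})$ such that $\int_{-\infty}^t\int_{\mathbb{R}^n}\frac{|u(x,\tau)|e^{-|x|^2/(4(t-\tau))}}{1+(t-\tau)^{\frac n2+1+s}}\,dx\,d\tau<\infty$ for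 every $t\in\mathbb{R}$. The parabolic Hölder space $C^{2\alpha,\alpha}_{x,t}$: for $0<\alpha\le\frac12$, $|u(x,t)-u(y,\tau)|\le C(|x-y|+|t-\tau|^{1/2})^{2\alpha}$; for $\frac12<\alpha\le1$, $u$ is $\alpha$-Hölder in $t$ uniformly in $x$ and $\nabla_x u$ is $(2\alpha-1)$-Hölder in $x$ uniformly in $t$ and $(\alpha-\frac12)$-Hölder in $t$ uniformly in $x$; for $\alpha>1$, $\partial_t u, D_x^2u\in C^{2\alpha-2,\alpha-1}_{x,t}$; ''loc'' means these hold locally. Notation: $T_\lambda=\{x\in\mathbb{R}^n\mid x_1=\lambda\}$, $\Sigma_\lambda=\{x\in\mathbb{R}^n\mid x_1<\lambda\}$, and $x^\lambda=(2\lambda-x_1,x_2,\dots,x_n)$. *)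

(* Defs.v *)
From HB Require Import structures.
From mathcomp Require Import all_boot all_order all_algebra.
From mathcomp Require Import all_classical all_reals all_analysis.
Set Implicit Arguments. Unset Strict Implicit. Unset Printing Implicit Defensive.
Import Order.TTheory GRing.Theory Num.Theory.
Import numFieldNormedType.Exports.
Local Open Scope classical_set_scope.
Local Open Scope ring_scope.

Section Defs.
Variable R : realType.
Variable n : nat.

(* points of R^n are functions 'I_n -> R; the coordinate x_1 of the paper
   is the coordinate of index 0 *)
Definition pt := 'I_n -> R.

Definition enorm (x : pt) : R := Num.sqrt (\sum_i (x i) ^+ 2).

Definition psub (x y : pt) : pt := fun i => x i - y i.

Definition Sigma (l : R) : set pt := [set x | forall i : 'I_n, val i = 0%N -> x i < l].
Definition SigmaBar (l : R) : set pt := [set x | forall i : 'I_n, val i = 0%N -> x i <= l].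
Definition refl (l : R) (x : pt) : pt :=
  fun i => if val i == 0%N then 2 * l - x i else x i.

Definition pdist (x : pt) (t : R) (y : pt) (tau : R) : R :=
  Num.sqrt (\sum_i (x i - y i) ^+ 2 + (t - tau) ^+ 2).

Definition upd (x : pt) (k : nat) (z : R) : pt := fun i => if val i == k then z else x i.

(* integral over R^n, as iterated one-dimensional Lebesgue integrals
   (coordinates of index < k are integrated, starting from base point x) *)
Fixpoint intRn_aux (k : nat) (f : pt -> \bar R) (x : pt) : \bar R :=
  match k with
  | 0%N => f x
  | k'.+1 => (\int[@lebesgue_measure R]_z intRn_aux k' f (upd x k' z))%E
  end.
Definition intRn (f : pt -> \bar R) : \bar R := intRn_aux n f (fun _ => 0).

Definition dx (i : 'I_n) (u : pt -> R -> R) : pt -> R -> R :=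
  fun x t => derive1 (fun h : R => u (upd x i h) t) (x i).
Definition dt (u : pt -> R -> R) : pt -> R -> R :=
  fun x t => derive1 (fun h : R => u x h) t.
Definition has_dx (i : 'I_n) (u : pt -> R -> R) (x : pt) (t : R) : Prop :=
  derivable (fun h : R => u (upd x i h) t) (x i) 1.
Definition has_dt (u : pt -> R -> R) (x : pt) (t : R) : Prop :=
  derivable (fun h : R => u x h) t 1.

Definition locally_on (D : pt -> R -> Prop) (P : R -> (pt -> R -> Prop) -> Prop) : Prop :=
  forall x0 t0, D x0 t0 -> exists r : R, 0 < r /\
    let B := fun x t => pdist x t x0 t0 < r in
    (forall x t, B x t -> D x t) /\ exists C : R, P C B.

(* parabolic Hölder space C^{2a,a}_{x,t,loc}(D); k is the number of times the
   rule "a > 1 => d_t u, D_x^2 u in C^{2a-2,a-1}" is applied *)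
Fixpoint HolderLoc (k : nat) (a : R) (D : pt -> R -> Prop) (u : pt -> R -> R) : Prop :=
  match k with
  | 0%N =>
    (0 < a <= 2^-1 /\
      locally_on D (fun C B => forall x t y tau, B x t -> B y tau ->
        `|u x t - u y tau| <= C * (enorm (psub x y) + `|t - tau| `^ (2^-1)) `^ (2 * a)))
    \/
    (2^-1 < a <= 1 /\
      (forall x t, D x t -> forall i, has_dx i u x t) /\
      locally_on D (fun C B =>
        (forall x t tau, B x t -> B x tau -> `|u x t - u x tau| <= C * `|t - tau| `^ a) /\
        (forall i x y t, B x t -> B y t ->
           `|dx i u x t - dx i u y t| <= C * enorm (psub x y) `^ (2 * a - 1)) /\
        (forall i x t tau, B x t -> B x tau ->
           `|dx i u x t - dx i u x tau| <= C * `|t - tau| `^ (a - 2^-1))))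
  | k'.+1 =>
    1 < a /\
    (forall x t, D x t -> has_dt u x t /\
       forall i, has_dx i u x t /\ forall j, has_dx j (dx i u) x t) /\
    HolderLoc k' (a - 1) D (dt u) /\
    (forall i j, HolderLoc k' (a - 1) D (dx j (dx i u)))
  end.

Definition HolderLocSpace (a : R) (D : pt -> R -> Prop) (u : pt -> R -> R) : Prop :=
  exists k : nat, HolderLoc k a D u.

Definition L1loc (u : pt -> R -> R) : Prop :=
  forall r : R, 0 < r ->
    (\int[@lebesgue_measure R]_tau
       intRn (fun x => (`|u x tau| * (\1_[set p : pt * R | enorm p.1 + `|p.2| <= r] (x, tau)))%:E)
      < +oo)%E.

Definition calL (s : R) (u : pt -> R -> R) : Prop :=
  L1loc u /\
  forall t : R,
    (\int[@lebesgue_measure R]_(tau in `]-oo, t[)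
       intRn (fun x => (`|u x tau| * expR (- (enorm x ^+ 2) / (4 * (t - tau)))
                          / (1 + (t - tau) `^ (n%:R / 2 + 1 + s)))%:E)
      < +oo)%E.

Definition Gamma (a : R) : R :=
  fine (\int[@lebesgue_measure R]_(z in `]0%R, +oo[) (z `^ (a - 1) * expR (- z))%:E)%E.
(* Gamma(-s) for 0 < s < 1, via Gamma(1 - s) = (-s) Gamma(-s) *)
Definition GammaNeg (s : R) : R := Gamma (1 - s) / (- s).

Definition Cns (s : R) : R :=
  1 / ((4 * pi) `^ (n%:R / 2) * `|GammaNeg s|).

(* fully fractional heat operator at (x,t); the y-integral is a principal value
   lim_{delta -> 0+} over {|x - y| > delta} *)
Definition fracHeat (s : R) (u : pt -> R -> R) (x : pt) (t : R) : \bar R :=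
  ((Cns s)%:E *
   \int[@lebesgue_measure R]_(tau in `]-oo, t[)
     lim ((fun delta : R =>
       intRn (fun y =>
         ((u x t - u y tau) / (t - tau) `^ (n%:R / 2 + 1 + s)
           * expR (- (enorm (psub x y) ^+ 2) / (4 * (t - tau)))
           * \1_[set z : pt | delta < enorm (psub x z)] y)%:E))
       @ (0 : R)^'+))%E.

End Defs.

(* Main.v *)
(** Suppose A = sup w > 0, let eps be a small multiple of A, and take (x0, t0)
    with w (x0, t0) > A - eps and rho half the distance from x0 to T_l.  Adding
    eps times the parabolic bump
      q (x, t) = 1 - |x - x0|^2 / rho^2 - (t - t0)^2 / rho^4
    to w produces an interior maximum (xb, tb) with q (xb, tb) > 0.  Put
    W = w (xb, tb) and h = eps (q - q (xb, tb)), or h = - eps.  Then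
    W - w >= h on Sigma_l, and h <= eps everywhere.  For fixed tau < tb the
    Gaussian kernel K of the operator is larger at y than at the reflected point
    y^l, so pairing y with y^l and using w (y^l) = - w (y) gives
      int (W - w) K >= int (h + 1_{y_1 > l} (2 W - 2 eps)) K.
    The right-hand side only involves Gaussian moments, the linear ones
    vanishing.  With a = tb - tau it is at least - C eps a^{-s} / rho^2 for
    a <= rho^2 (up to the common factor), while for a > rho^2 the mass of K
    beyond T_l makes it at least c A a^{-1-s}.  Both contributions scale like
    rho^{-2s} after integration in tau, so for eps / A small the operator is
    positive at (xb, tb), where w is positive: a contradiction. *)

Require Import Defs.
From HB Require Import structures.
From mathcomp Require Import all_boot all_order all_algebra.
From mathcomp Require Import all_classical all_reals all_analysis.
From mathcomp Require Import measurable_realfun ring lra.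
Import Order.TTheory GRing.Theory Num.Theory.
Import numFieldNormedType.Exports.
Local Open Scope classical_set_scope.
Local Open Scope ring_scope.

Set Implicit Arguments. Unset Strict Implicit. Unset Printing Implicit Defensive.

(** * Comparison of integrals when only one side is measurable *)

Section integral_comparison.
Local Open Scope ereal_scope.
Context d (T : measurableType d) (R : realType).
Variable mu : {measure set T -> \bar R}.
Import HBNNSimple.

(** The integral of a nonnegative function is a supremum over the simple functions below it, so it
    is monotone without any measurability. This matters in the end because the time integrand of
    [fracHeat], a limit for each [tau], is never shown to be measurable. *)
Lemma le_integral_ge0 (f g : T -> \bar R) :
  (forall x, 0 <= f x) -> (forall x, f x <= g x) ->
  \int[mu]_x f x <= \int[mu]_x g x.
Proof.
move=> f0 fg; have g0 x : 0 <= g x := le_trans (f0 x) (fg x).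
rewrite !ge0_integralTE//; apply: ereal_sup_le => _ [h /= hf <-].
by exists h => // x; exact: le_trans (hf x) (fg x).
Qed.

(** Each simple function below [f] is almost everywhere below the measurable [g]. *)
Lemma ae_le_integral_ub (f g : T -> \bar R) : measurable_fun setT g ->
  (forall x, 0 <= f x) -> (forall x, 0 <= g x) ->
  {ae mu, forall x, f x <= g x} -> \int[mu]_x f x <= \int[mu]_x g x.
Proof.
move=> mg f0 g0 fg; rewrite [leLHS]ge0_integralTE//.
apply: ge_ereal_sup => _ [h /= hf <-]; rewrite -integralT_nnsfun.
apply: ae_ge0_le_integral => //.
- by move=> x _; rewrite lee_fin.
- exact/measurable_EFinP.
- by apply: filterS fg => x fg _; exact: le_trans (hf x) fg.
Qed.

(** As [g] is measurable, the exceptional null set can be deleted from its integral; off that set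
    the comparison is pointwise. *)
Lemma ae_le_integral_lb (f g : T -> \bar R) : measurable_fun setT g ->
  (forall x, 0 <= f x) -> (forall x, 0 <= g x) ->
  {ae mu, forall x, g x <= f x} -> \int[mu]_x g x <= \int[mu]_x f x.
Proof.
move=> mg f0 g0 [N [mN N0 gf]].
rewrite (ge0_negligible_integral mN)// setTD integral_mkcond.
apply: le_integral_ge0 => x; rewrite patchE; case: ifPn => // /set_mem Nx.
by apply: contrapT => h; apply: Nx; apply: gf.
Qed.

(* The convention [+oo - +oo = -oo] makes the difference of the positive and
   negative parts monotone even when both are infinite. *)
Lemma ae_le_integral (f g : T -> \bar R) : measurable_fun setT g ->
  {ae mu, forall x, g x <= f x} -> \int[mu]_x g x <= \int[mu]_x f x.
Proof.
move=> mg gf; rewrite integralE [leRHS]integralE; apply: leeB.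
- apply: ae_le_integral_lb => //; first exact: measurable_funepos.
  by apply: filterS gf => x gf; rewrite !funeposE ge_max !le_max lexx gf orbT.
- apply: ae_le_integral_ub => //; first exact: measurable_funeneg.
  by apply: filterS gf => x gf; rewrite !funenegE ge_max !le_max lexx leeN2 gf orbT.
Qed.

End integral_comparison.

(** * Reflection invariance of Lebesgue measure *)

Section lebesgue_reflection.
Context {R : realType}.
Local Notation mu := (@lebesgue_measure R).

Lemma measurable_fun_reflect (c : R) :
  measurable_fun setT ((fun z => c - z) : measurableTypeR R -> measurableTypeR R).
Proof. exact: measurable_funB. Qed.

(** By uniqueness of Lebesgue measure it suffices to look at intervals: the preimage of []a, b]] is
    [[c - b, c - a[], of the same length. *)
Lemma lebesgue_measure_reflect (c : R) (A : set R) : measurable A ->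
  pushforward mu ((fun z => c - z) : measurableTypeR R -> measurableTypeR R) A = mu A.
Proof.
move=> mA.
have mphi := measurable_fun_reflect c.
pose mphi_mixin := isMeasurableFun.Build _ _ _ _ _ mphi.
pose phi : {mfun measurableTypeR R >-> measurableTypeR R} :=
  HB.pack ((fun z => c - z) : measurableTypeR R -> measurableTypeR R) mphi_mixin.
apply/esym/(@lebesgue_measure_unique R (pushforward mu phi)) => //= _ [[a b]] _ <-.
rewrite /pushforward (_ : _ @^-1` _ = `[c - b, c - a[%classic); last first.
  by apply/seteqP; split => z /=; rewrite !in_itv/= => /andP[h1 h2];
    apply/andP; split; lra.
rewrite !lebesgue_measure_itv/= !lte_fin.
have -> : (c - b < c - a) = (a < b) by apply/idP/idP => ?; lra.
by case: ifP => // _; rewrite -!EFinB; congr (_%:E); ring.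
Qed.

Lemma integral_reflect (c : R) (f : R -> \bar R) : measurable_fun setT f ->
  (\int[mu]_z f (c - z)%R = \int[mu]_z f z)%E.
Proof.
move=> mf.
have ge0 g : measurable_fun setT g -> (forall z, 0 <= g z)%E ->
    (\int[mu]_z g (c - z)%R = \int[mu]_z g z)%E.
  move=> mg g0.
  have := @ge0_integral_pushforward _ _ _ _ R _ (measurable_fun_reflect c) mu
    setT g measurableT mg (fun y _ => g0 y).
  rewrite preimage_setT => <-.
  apply: eq_measure_integral => [|mphi A mA _]; first exact: measurable_fun_reflect.
  exact: lebesgue_measure_reflect.
rewrite integralE [RHS]integralE; congr (_ - _)%E.
  rewrite -[RHS](ge0 _ (measurable_funepos mf))//.
  by apply: eq_integral => z _; rewrite !funeposE.
rewrite -[RHS](ge0 _ (measurable_funeneg mf))//.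
by apply: eq_integral => z _; rewrite !funenegE.
Qed.

(** Reflection at [c] turns the integral into its opposite, and integrability makes it finite. *)
Lemma integral_odd (c : R) (f : R -> R) :
  mu.-integrable setT (EFin \o f) -> (forall z, f (2 * c - z) = - f z) ->
  (\int[mu]_z (f z)%:E = 0)%E.
Proof.
move=> intf odd; have mf := measurable_int _ intf.
have := integral_reflect (2 * c) mf.
under eq_integral do rewrite /= odd.
have [r Er] : exists r : R, (\int[mu]_z (f z)%:E = r%:E)%E.
  by exists (fine (\int[mu]_z (f z)%:E)%E); rewrite fineK// integrable_fin_num.
under eq_integral do rewrite EFinN; rewrite integralN ?integrable_add_def//.
by rewrite Er => -[h]; congr (_%:E); lra.
Qed.

End lebesgue_reflection.

(** * Measurability and convergence of iterated integrals over R^n *)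

Section measurable_points.
Variables (R : realType) (n : nat).
Local Notation mu := (@lebesgue_measure R).

(** Generators of the product sigma-algebra on R^n; [mpt] is [pt] equipped with it. *)
Definition coord_preimages : set (set (pt R n)) :=
  [set A | exists (i : 'I_n) (B : set R),
    measurable B /\ A = (fun x : pt R n => x i) @^-1` B].

Definition mpt := g_sigma_algebraType coord_preimages.

Lemma measurable_coord (i : 'I_n) : measurable_fun setT (fun x : mpt => x i).
Proof.
move=> _ B mB; rewrite setTI; apply: sub_sigma_algebra.
by exists i, B.
Qed.

Lemma measurable_fun_mpt d (T : measurableType d) (F : T -> mpt) :
  (forall i, measurable_fun setT (fun t => F t i)) -> measurable_fun setT F.
Proof.
move=> mF; apply: (@measurability _ _ T mpt setT F coord_preimages) => //.
move=> _ [_ [i [B [mB ->]]] <-].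
exact: (mF i measurableT B mB).
Qed.

Lemma measurable_upd d (T : measurableType d) (F : T -> mpt) (h : T -> R) k :
  measurable_fun setT F -> measurable_fun setT h ->
  measurable_fun setT (fun t => upd (F t) k (h t) : mpt).
Proof.
move=> mF mh; apply: measurable_fun_mpt => i; rewrite /upd.
case: (val i == k) => //.
exact: (measurableT_comp (measurable_coord i) mF).
Qed.

Lemma measurable_refl d (T : measurableType d) (F : T -> mpt) (l : R) :
  measurable_fun setT F -> measurable_fun setT (fun t => refl l (F t) : mpt).
Proof.
move=> mF; apply: measurable_fun_mpt => i; rewrite /refl.
have mi := measurableT_comp (measurable_coord i) mF.
by case: (val i == 0%N) => //; apply: measurable_funB.
Qed.

(** Tonelli's theorem applies to the positive and the negative part separately, so no integrability
    of [f] is asked for. *)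
Lemma measurable_fun_integralR d (T : measurableType d) (f : T -> R -> \bar R) :
  measurable_fun setT (fun p : T * measurableTypeR R => f p.1 p.2) ->
  measurable_fun setT (fun t => \int[mu]_z f t z)%E.
Proof.
move=> mf.
have mpos := @measurable_fun_fubini_tonelli_F _ _ _ _ R mu _ (measurable_funepos mf)
  (fun x => funepos_ge0 _ x).
have mneg := @measurable_fun_fubini_tonelli_F _ _ _ _ R mu _ (measurable_funeneg mf)
  (fun x => funeneg_ge0 _ x).
have := emeasurable_funB mpos mneg; congr (measurable_fun _ _).
apply/funext => t; rewrite [RHS]integralE /fubini_F; congr (_ - _)%E.
  by apply: eq_integral => z _; rewrite !funeposE.
by apply: eq_integral => z _; rewrite !funenegE.
Qed.

(** The parameter space [T] is arbitrary so that the induction can absorb the variable being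
    integrated, passing from [T] to [T * R]. *)
Lemma measurable_intRn_aux d (T : measurableType d) (f : T -> mpt -> \bar R) k
    (F : T -> mpt) :
  measurable_fun setT (fun p : T * mpt => f p.1 p.2) -> measurable_fun setT F ->
  measurable_fun setT (fun t => intRn_aux k (f t) (F t)).
Proof.
move=> mf; elim: k d T f mf F => [|k IH] d T f mf F mF /=.
  exact: (measurableT_comp mf (measurable_fun_pair (@measurable_id _ _ _) mF)).
apply: measurable_fun_integralR.
apply: (IH _ (T * measurableTypeR R)%type (fun p => f p.1) _
  (fun p => upd (F p.1) k p.2 : mpt)).
  have h : measurable_fun setT
      (fun q : (T * measurableTypeR R) * mpt => (q.1.1, q.2)).
    by apply: measurable_fun_pair => //; exact: measurableT_comp.
  exact: (measurableT_comp mf h).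
apply: measurable_upd; last exact: measurable_snd.
exact: measurableT_comp.
Qed.

Lemma measurable_intRn_aux_upd (f : mpt -> \bar R) k j (x : mpt) :
  measurable_fun setT f ->
  measurable_fun setT (fun z : measurableTypeR R => intRn_aux k f (upd x j z)).
Proof.
move=> mf; apply: (@measurable_intRn_aux _ (measurableTypeR R) (fun=> f)).
  by apply: measurableT_comp => //; exact: measurable_snd.
by apply: measurable_upd.
Qed.

Local Open Scope ereal_scope.

Lemma intRn_aux_ge0 (f : mpt -> \bar R) k x :
  (forall x, 0 <= f x) -> 0 <= intRn_aux k f x.
Proof. by move=> f0; elim: k x => //= k IH x; apply: integral_ge0. Qed.

Lemma le_intRn_aux (f g : mpt -> \bar R) k x : (forall x, 0 <= f x) ->
  (forall x, f x <= g x) -> intRn_aux k f x <= intRn_aux k g x.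
Proof.
move=> f0 fg; elim: k x => //= k IH x.
by apply: le_integral_ge0 => // z; exact: intRn_aux_ge0.
Qed.

Lemma intRn_auxZl (f : mpt -> \bar R) k x (c : R) : measurable_fun setT f ->
  (forall x, 0 <= f x) -> (0 <= c)%R ->
  intRn_aux k (fun x => c%:E * f x) x = c%:E * intRn_aux k f x.
Proof.
move=> mf f0 c0; elim: k x => //= k IH x.
under eq_integral do rewrite IH.
rewrite ge0_integralZl//; first exact: measurable_intRn_aux_upd.
by move=> z _; exact: intRn_aux_ge0.
Qed.

Lemma intRn_auxD (f g : mpt -> \bar R) k x :
  measurable_fun setT f -> measurable_fun setT g ->
  (forall x, 0 <= f x) -> (forall x, 0 <= g x) ->
  intRn_aux k (fun x => f x + g x) x = intRn_aux k f x + intRn_aux k g x.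
Proof.
move=> mf mg f0 g0; elim: k x => //= k IH x.
under eq_integral do rewrite IH.
rewrite ge0_integralD//; try exact: measurable_intRn_aux_upd.
all: by move=> z _; exact: intRn_aux_ge0.
Qed.

Lemma le_abse_intRn_aux (f : mpt -> \bar R) k x : measurable_fun setT f ->
  `|intRn_aux k f x| <= intRn_aux k (fun y => `|f y|) x.
Proof.
move=> mf; elim: k x => //= k IH x.
apply: le_trans (le_abse_integral _ _ _) _ => //.
  exact: measurable_intRn_aux_upd.
exact: le_integral_ge0.
Qed.

Lemma ae_intRn_aux_lty (f : mpt -> \bar R) k x : measurable_fun setT f ->
  (forall x, 0 <= f x) -> intRn_aux k.+1 f x < +oo ->
  {ae mu, forall z, intRn_aux k f (upd x k z) < +oo}.
Proof.
move=> mf f0 foo.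
have : mu.-integrable setT (fun z => intRn_aux k f (upd x k z)).
  apply/integrableP; split; first exact: measurable_intRn_aux_upd.
  apply: le_lt_trans foo => /=; rewrite le_eqVlt; apply/orP; left; apply/eqP.
  by apply: eq_integral => z _; rewrite gee0_abs// intRn_aux_ge0.
move/(integrable_ae measurableT); apply: filterS => z /(_ Logic.I).
by rewrite ge0_fin_numE// intRn_aux_ge0.
Qed.

(** Dominated convergence is applied one coordinate at a time. The slices of [g] have finite
    integral for almost every [z] only, which is enough for the outer integral. *)
Lemma intRn_aux_dominated (f_ : (mpt -> \bar R)^nat) (f g : mpt -> \bar R) k x :
  (forall m, measurable_fun setT (f_ m)) -> measurable_fun setT f ->
  measurable_fun setT g -> (forall y, f_ ^~ y @ \oo --> f y) ->
  (forall m y, `|f_ m y| <= g y) -> intRn_aux k g x < +oo ->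
  (fun m => intRn_aux k (f_ m) x) @ \oo --> intRn_aux k f x.
Proof.
move=> mf_ mf mg f_f f_g.
have g0 y : 0 <= g y by apply: le_trans (f_g 0%N y); exact: abse_ge0.
elim: k x => //= k IH x goo.
have gae := ae_intRn_aux_lty mg g0 goo.
have [|||||_ _ //] := @dominated_convergence _ _ R mu setT measurableT
  (fun m z => intRn_aux k (f_ m) (upd x k z))
  (fun z => intRn_aux k f (upd x k z)) (fun z => intRn_aux k g (upd x k z)).
- by move=> m; exact: measurable_intRn_aux_upd.
- exact: measurable_intRn_aux_upd.
- by apply: (@filterS _ _ (ae_filter_ringOfSetsType mu) _ _ _ gae) => z goo' _; exact: IH.
- apply/integrableP; split; first exact: measurable_intRn_aux_upd.
  apply: le_lt_trans goo => /=; rewrite le_eqVlt; apply/orP; left; apply/eqP.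
  by apply: eq_integral => z _; rewrite gee0_abs// intRn_aux_ge0.
- apply: aeW => z m _; apply: le_trans (le_abse_intRn_aux _ _ (mf_ m)) _.
  by apply: le_intRn_aux => // y; exact: abse_ge0.
Qed.

End measurable_points.

(** * One-dimensional Gaussian moments, tails and pairing *)

Section gaussian.
Context {R : realType}.
Local Notation mu := (@lebesgue_measure R).
Implicit Types a c l z : R.

(** The heat kernel at time [a] centred at [c], without its normalising factor. *)
Definition gauss c a z : R := expR (- (c - z) ^+ 2 / (4 * a)).

Lemma gauss_gt0 c a z : 0 < gauss c a z.
Proof. exact: expR_gt0. Qed.

Lemma measurable_gauss c a : measurable_fun setT (gauss c a).
Proof.
apply: measurableT_comp => //; apply: measurable_funM => //.
by apply: measurableT_comp => //; apply: measurable_funX; exact: measurable_funB.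
Qed.

(** Up to the total mass, this is the normal density of mean [c] and variance [2 * a]. *)
Lemma integral_gauss c a : 0 < a ->
  (\int[mu]_z (gauss c a z)%:E = (Num.sqrt (4 * pi * a))%:E)%E.
Proof.
move=> a0; pose s := Num.sqrt (2 * a).
have s2 : s ^+ 2 = 2 * a by rewrite sqr_sqrtr//; lra.
have s0 : s != 0 by rewrite gt_eqF// sqrtr_gt0; lra.
have M0 : 0 < Num.sqrt (4 * pi * a) :> R.
  by rewrite sqrtr_gt0 !mulr_gt0// pi_gt0.
have E z : (gauss c a z)%:E = ((Num.sqrt (4 * pi * a))%:E * (normal_pdf c s z)%:E)%E.
  rewrite normal_pdfE// /normal_peak /normal_fun -EFinM s2; congr (_%:E).
  have -> : 2 * a * pi *+ 2 = 4 * pi * a by ring.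
  rewrite mulrA divff ?gt_eqF// mul1r /gauss; congr expR.
  have -> : 2 * a *+ 2 = 4 * a by ring.
  by rewrite -[in RHS]sqrrN opprB.
under eq_integral do rewrite E.
rewrite integralZl//; last exact: integrable_normal_pdf.
by rewrite integral_normal_pdf mule1.
Qed.

Lemma integrable_gauss c a : 0 < a -> mu.-integrable setT (EFin \o gauss c a).
Proof.
move=> a0; apply/integrableP; split.
  by apply/measurable_EFinP; exact: measurable_gauss.
under eq_integral do rewrite /= ger0_norm ?(ltW (gauss_gt0 _ _ _))//.
by rewrite integral_gauss// ltry.
Qed.

(* From [u <= expR u] at [u = (c - z)^2 / (8 a)]. *)
Lemma sqr_gauss_le c a z : 0 < a ->
  (c - z) ^+ 2 * gauss c a z <= 8 * a * gauss c (2 * a) z.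
Proof.
move=> a0; set u := (c - z) ^+ 2 / (8 * a).
have -> : (c - z) ^+ 2 = 8 * a * u by rewrite /u; field; lra.
have -> : gauss c a z = expR (- u) * expR (- u).
  by rewrite -expRD /gauss; congr expR; rewrite /u; field; lra.
have -> : gauss c (2 * a) z = expR (- u).
  by rewrite /gauss; congr expR; rewrite /u; field; lra.
have u1 : u * expR (- u) <= 1.
  rewrite expRN ler_pdivrMr ?expR_gt0// mul1r.
  by apply: le_trans (expR_ge1Dx u); rewrite lerDr.
have e0 := expR_gt0 (- u).
have -> : 8 * a * u * (expR (- u) * expR (- u)) =
  (8 * a * expR (- u)) * (u * expR (- u)) by ring.
by rewrite -[leRHS]mulr1 ler_wpM2l// !mulr_ge0// ltW.
Qed.

Lemma integrable_sqr_gauss c a : 0 < a ->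
  mu.-integrable setT (EFin \o (fun z => (c - z) ^+ 2 * gauss c a z)).
Proof.
move=> a0; apply: (@le_integrable _ _ _ mu setT measurableT _
    (fun z => (8 * a)%:E * (gauss c (2 * a) z)%:E)%E).
- apply/measurable_EFinP; apply: measurable_funM; last exact: measurable_gauss.
  by apply: measurable_funX; exact: measurable_funB.
- move=> z _ /=; rewrite lee_fin ger0_norm; last first.
    by rewrite mulr_ge0 ?sqr_ge0// ltW ?gauss_gt0.
  apply: le_trans (sqr_gauss_le c z a0) _; exact: ler_norm.
- by apply: integrableZl => //; apply: integrable_gauss; lra.
Qed.

(** The pointwise bound integrates to [8 * a * Num.sqrt (8 * pi * a)], and [Num.sqrt 2 <= 2]. The
    exact second moment has 2 in place of 16; any constant serves. *)
Lemma integral_sqr_gauss_le c a : 0 < a ->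
  (\int[mu]_z ((c - z) ^+ 2 * gauss c a z)%:E <=
    (16 * a * Num.sqrt (4 * pi * a))%:E)%E.
Proof.
move=> a0; have a20 : 0 < 2 * a by lra.
apply: (@le_trans _ _ (\int[mu]_z ((8 * a)%:E * (gauss c (2 * a) z)%:E)%E)%E).
  apply: le_integral_ge0 => z; rewrite ?lee_fin ?sqr_gauss_le//.
  by rewrite mulr_ge0 ?sqr_ge0// ltW ?gauss_gt0.
rewrite integralZl//; last exact: integrable_gauss.
rewrite integral_gauss// -EFinM lee_fin.
have -> : 4 * pi * (2 * a) = 2 * (4 * pi * a) by ring.
rewrite sqrtrM//.
have s2 : Num.sqrt 2 <= 2 :> R.
  by rewrite -[leRHS]ger0_norm// -sqrtr_sqr ler_sqrt; nra.
have -> : 16 * a * Num.sqrt (4 * pi * a) = 8 * a * (2 * Num.sqrt (4 * pi * a)) by ring.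
by rewrite ler_wpM2l ?ler_wpM2r ?sqrtr_ge0//; lra.
Qed.

Lemma integrable_lin_gauss c a : 0 < a ->
  mu.-integrable setT (EFin \o (fun z => (z - c) * gauss c a z)).
Proof.
move=> a0; apply: (@le_integrable _ _ _ mu setT measurableT _
    ((EFin \o gauss c a) \+ (EFin \o (fun z => ((c - z) ^+ 2 * gauss c a z)%R)))%E).
- apply/measurable_EFinP; apply: measurable_funM; last exact: measurable_gauss.
  exact: measurable_funB.
- move=> z _ /=; rewrite lee_fin normrM (ger0_norm (ltW (gauss_gt0 _ _ _))).
  have g0 := ltW (gauss_gt0 c a z).
  have h0 : 0 <= gauss c a z + (c - z) ^+ 2 * gauss c a z.
    by apply: addr_ge0 => //; apply: mulr_ge0 => //; exact: sqr_ge0.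
  rewrite (ger0_norm h0).
  rewrite -[X in _ <= X + _]mul1r -mulrDl ler_wpM2r ?(ltW (gauss_gt0 _ _ _))//.
  rewrite -sqrrN opprB -real_normK ?num_real//.
  have := sqr_ge0 (`|z - c| - 1); have := normr_ge0 (z - c); nra.
- by apply: integrableD => //; [exact: integrable_gauss|exact: integrable_sqr_gauss].
Qed.

Lemma integral_lin_gauss c a : 0 < a ->
  (\int[mu]_z ((z - c) * gauss c a z)%:E = 0)%E.
Proof.
move=> a0; apply: (@integral_odd _ c); first exact: integrable_lin_gauss.
move=> z; rewrite /gauss.
have -> : (c - (2 * c - z)) ^+ 2 = (c - z) ^+ 2 by ring.
by ring.
Qed.

Lemma integrable_gauss_tail c a l : 0 < a ->
  mu.-integrable setT (EFin \o (fun z => \1_`]l, +oo[ z * gauss c a z)).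
Proof.
move=> a0; apply: (@le_integrable _ _ _ mu setT measurableT _
    (EFin \o gauss c a)).
- apply/measurable_EFinP; apply: measurable_funM; last exact: measurable_gauss.
  exact: measurable_indic.
- move=> z _ /=; rewrite lee_fin normrM -[leRHS]mul1r ler_wpM2r//.
  by rewrite indicE; case: (_ \in _); rewrite ?normr1 ?normr0.
- exact: integrable_gauss.
Qed.

(** With [r] the root of [a], the interval []c + 3 * r, c + 4 * r]] lies beyond [l], has length [r],
    and on it the exponent is at least -16/4 = -4. The factor 3 fits a maximum point within three
    radii of the hyperplane. *)
Lemma gauss_tail_ge c a l : 0 < a -> l - c <= 3 * Num.sqrt a ->
  ((expR (- 4) * Num.sqrt a)%:E <= \int[mu]_z (\1_`]l, +oo[ z * gauss c a z)%:E)%E.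
Proof.
move=> a0 lc; have s0 : 0 < Num.sqrt a by rewrite sqrtr_gt0.
have s2 : Num.sqrt a ^+ 2 = a by rewrite sqr_sqrtr// ltW.
set r := Num.sqrt a in lc s0 s2 *.
have mI : measurable (`]c + 3 * r, c + 4 * r] : set R) by [].
apply: (@le_trans _ _ (\int[mu]_z ((expR (- 4))%:E *
    (\1_(`]c + 3 * r, c + 4 * r] : set R) z)%:E)%E)%E).
  rewrite ge0_integralZl//; last by apply/measurable_EFinP; exact: measurable_indic.
  rewrite integral_indic//= setIT lebesgue_measure_itv/= lte_fin ifT; last lra.
  by rewrite -EFinB -EFinM lee_fin; rewrite le_eqVlt; apply/orP; left; apply/eqP; ring.
apply: le_integral_ge0 => z.
  by rewrite -EFinM lee_fin mulr_ge0// ltW ?expR_gt0.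
rewrite -EFinM lee_fin !indicE.
have [/set_mem/=|_] := boolP (z \in _); last first.
  by rewrite mulr0 mulr_ge0// ltW// gauss_gt0.
rewrite in_itv/= => /andP[z1 z2].
rewrite mem_set/= ?in_itv/=; last by rewrite andbT; lra.
rewrite mulr1 mul1r ler_expR mulNr lerN2 ler_pdivrMr; last lra.
by nra.
Qed.

(** The linear term integrates to zero, the quadratic one costs at most a second moment, and the
    tail yields a fraction [p] of the total mass. Leaving [p] and [D] free lets one estimate serve
    every coordinate. *)
Lemma gauss_poly_ge c a l p (al be ga D : R) : 0 < a -> 0 <= ga -> 0 <= D ->
  ((p * Num.sqrt (4 * pi * a))%:E <= \int[mu]_z (\1_`]l, +oo[ z * gauss c a z)%:E)%E ->
  mu.-integrable setT (fun z => (gauss c a z *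
     (al + be * (z - c) - ga * (z - c) ^+ 2 + D * \1_`]l, +oo[ z))%:E) /\
  ((Num.sqrt (4 * pi * a) * (al - ga * (16 * a) + D * p))%:E <=
   \int[mu]_z (gauss c a z *
     (al + be * (z - c) - ga * (z - c) ^+ 2 + D * \1_`]l, +oo[ z))%:E)%E.
Proof.
move=> a0 ga0 D0 htail.
pose f1 z := (al%:E * (gauss c a z)%:E)%E.
pose f2 z := (be%:E * ((z - c) * gauss c a z)%:E)%E.
pose f3 z := (ga%:E * ((c - z) ^+ 2 * gauss c a z)%:E)%E.
pose f4 z := (D%:E * (\1_`]l, +oo[ z * gauss c a z)%:E)%E.
have i1 : mu.-integrable setT f1 by apply: integrableZl => //; exact: integrable_gauss.
have i2 : mu.-integrable setT f2.
  by apply: integrableZl => //; exact: integrable_lin_gauss.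
have i3 : mu.-integrable setT f3.
  by apply: integrableZl => //; exact: integrable_sqr_gauss.
have i4 : mu.-integrable setT f4.
  by apply: integrableZl => //; exact: integrable_gauss_tail.
have E : (fun z => (gauss c a z *
     (al + be * (z - c) - ga * (z - c) ^+ 2 + D * \1_`]l, +oo[ z))%:E) =
  (fun z => (f1 \+ f2 \+ f4) z - f3 z)%E.
  by apply/funext => z; rewrite /f1 /f2 /f3 /f4 -!EFinM -!EFinD; congr (_%:E); ring.
have i12 : mu.-integrable setT (f1 \+ f2)%E by exact: integrableD.
have i124 : mu.-integrable setT (f1 \+ f2 \+ f4)%E by exact: integrableD.
rewrite E; split; first exact: integrableB.
rewrite integralB// integralD// integralD//.
rewrite !integralZl//; [|exact: integrable_sqr_gauss|exact: integrable_gauss_tail|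
  exact: integrable_lin_gauss|exact: integrable_gauss].
rewrite integral_gauss// integral_lin_gauss// mule0 adde0.
apply: (@le_trans _ _ ((al * Num.sqrt (4 * pi * a))%:E +
   D%:E * (p * Num.sqrt (4 * pi * a))%:E
   - ga%:E * (16 * a * Num.sqrt (4 * pi * a))%:E)%E).
  by rewrite -!EFinM -!EFinD lee_fin le_eqVlt; apply/orP; left; apply/eqP; ring.
apply: leeB; last by apply: lee_wpmul2l => //; exact: integral_sqr_gauss_le.
by apply: leeD; [rewrite -EFinM|apply: lee_wpmul2l].
Qed.

(* Each side integrates to twice the integral of the original function. *)
Lemma le_integral_pairing l (f g : R -> R) :
  mu.-integrable setT (EFin \o f) -> mu.-integrable setT (EFin \o g) ->
  (forall z, z < l -> g z + g (2 * l - z) <= f z + f (2 * l - z)) ->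
  (\int[mu]_z (g z)%:E <= \int[mu]_z (f z)%:E)%E.
Proof.
move=> intf intg gf.
have refl2 h : mu.-integrable setT (EFin \o h) ->
    exists r : R, (\int[mu]_z (h z)%:E = r%:E)%E /\
      (\int[mu]_z (h z + h (2 * l - z))%:E = (2 * r)%:E)%E.
  move=> inth; have mh := measurable_int _ inth.
  have refl_int := integral_reflect (2 * l) mh.
  have inthr : mu.-integrable setT (fun z => (h (2 * l - z))%:E).
    have mhr : measurable_fun setT (fun z => (h (2 * l - z))%:E).
      exact: (measurableT_comp mh (measurable_fun_reflect _)).
    apply/integrableP; split=> //.
    have mabs : measurable_fun setT (fun z => `|(h z)%:E|)%E.
      exact: (measurableT_comp _ mh).
    rewrite (integral_reflect (2 * l) mabs).
    by have /integrableP[] := inth.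
  have [r Er] : exists r : R, (\int[mu]_z (h z)%:E = r%:E)%E.
    by exists (fine (\int[mu]_z (h z)%:E)%E); rewrite fineK// integrable_fin_num.
  exists r; split => //; under eq_integral do rewrite EFinD.
  by rewrite integralD// refl_int Er -EFinD; congr (_%:E); ring.
have [rf [Ef Ef2]] := refl2 _ intf; have [rg [Eg Eg2]] := refl2 _ intg.
suff : ((2 * rg)%:E <= (2 * rf)%:E)%E.
  by rewrite Ef Eg !lee_fin ler_pM2l.
rewrite -Ef2 -Eg2; apply: ae_le_integral.
  have mg : measurable_fun setT g by apply/measurable_EFinP; exact: measurable_int intg.
  apply/measurable_EFinP; apply: measurable_funD => //.
  exact: (measurableT_comp mg (measurable_fun_reflect _)).
(* The hypothesis covers [z < l], and [z > l] by exchanging the two paired points; only the fixed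
   point [l] is left out. *)
exists [set l]; split => //; first exact: lebesgue_measure_set1.
move=> z /= h; apply: contrapT => /eqP; rewrite neq_lt => /orP[zl|lz]; apply: h.
  by rewrite lee_fin gf.
rewrite lee_fin addrC [leRHS]addrC.
have {2 4}-> : z = 2 * l - (2 * l - z) by ring.
by apply: gf; lra.
Qed.

End gaussian.

(** * Lower bound for the space integral by pairing reflected points *)

Section gaussian_lower_bound.
Variables (R : realType) (n : nat) (c : pt R n) (a : R).
Hypothesis a0 : 0 < a.
Local Notation mu := (@lebesgue_measure R).
Local Notation M0 := (Num.sqrt (4 * pi * a)).

(** The Gaussian factors of the coordinates that [intRn_aux k] leaves fixed; [gprod 0] is the full
    kernel. *)
Definition gprod k (y : pt R n) : R := \prod_(i < n | (k <= i)%N) gauss (c i) a (y i).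

Lemma gprod0E (y : pt R n) : expR (- (enorm (psub c y) ^+ 2) / (4 * a)) = gprod 0 y.
Proof.
rewrite /enorm sqr_sqrtr; last by apply: sumr_ge0 => i _; exact: sqr_ge0.
rewrite /gprod /gauss -expR_sum -mulr_suml -sumrN.
by congr (expR (_ / _)); apply: eq_big => // i _.
Qed.

Lemma gprod_gt0 k y : 0 < gprod k y.
Proof. by apply: prodr_gt0 => i _; exact: gauss_gt0. Qed.

Lemma gprod_upd k (kn : (k < n)%N) y z :
  gprod k (upd y k z) = gauss (c (Ordinal kn)) a z * gprod k.+1 y.
Proof.
rewrite /gprod (bigD1 (Ordinal kn))//= /upd/= eqxx; congr (_ * _).
apply: eq_big => [i|i /andP[_ ik]].
  by rewrite ltn_neqAle -val_eqE/= eq_sym andbC.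
by rewrite -val_eqE/= in ik; rewrite (negbTE ik).
Qed.

Lemma gprod_n y : gprod n y = 1.
Proof.
by rewrite /gprod big_pred0// => i; apply/negbTE; rewrite -ltnNge ltn_ord.
Qed.

Lemma measurable_gprod k : measurable_fun setT (gprod k : mpt R n -> R).
Proof.
rewrite (_ : gprod k = fun y : mpt R n => \prod_(i <- enum 'I_n)
    (if (k <= i)%N then gauss (c i) a (y i) else 1)); last first.
  by apply/funext => y; rewrite /gprod big_mkcond big_enum.
apply: measurable_prod => i _; case: (k <= i)%N => //.
exact: (measurableT_comp (measurable_gauss (c i) a) (measurable_coord i)).
Qed.

Lemma intRn_aux_gprod k x : (k <= n)%N ->
  intRn_aux k (fun y => (gprod 0 y)%:E) x = (M0 ^+ k * gprod k x)%:E.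
Proof.
elim: k x => [|k IH] x kn; first by rewrite expr0 mul1r.
rewrite /=; under eq_integral do rewrite IH ?(ltnW kn)// (gprod_upd kn).
under eq_integral do rewrite (mulrC (gauss _ _ _)) mulrA EFinM.
rewrite integralZl//; last exact: integrable_gauss.
by rewrite integral_gauss// -EFinM; congr (_%:E); rewrite exprS; ring.
Qed.

Variables (be : 'I_n -> R) (ga : R).
Hypothesis ga0 : 0 <= ga.

(** Here [al + hsum 0 y] is the quadratic barrier [h] below [W - u], expanded around the centre [c];
    [hsum k] keeps the coordinates not yet integrated. *)
Definition hsum k (y : pt R n) : R :=
  \sum_(i < n | (k <= i)%N) (be i * (y i - c i) - ga * (y i - c i) ^+ 2).

Lemma hsum_upd k (kn : (k < n)%N) y z : hsum k (upd y k z) =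
  be (Ordinal kn) * (z - c (Ordinal kn)) - ga * (z - c (Ordinal kn)) ^+ 2
  + hsum k.+1 y.
Proof.
rewrite /hsum (bigD1 (Ordinal kn))//= /upd/= eqxx; congr (_ + _).
apply: eq_big => [i|i /andP[_ ik]].
  by rewrite ltn_neqAle -val_eqE/= eq_sym andbC.
by rewrite -val_eqE/= in ik; rewrite (negbTE ik).
Qed.

Lemma hsum_n y : hsum n y = 0.
Proof.
by rewrite /hsum big_pred0// => i; apply/negbTE; rewrite -ltnNge ltn_ord.
Qed.

Variables (l W e al ka p : R) (u : pt R n -> R) (F : mpt R n -> R).
Hypothesis n0 : (0 < n)%N.
Let c0 := c (Ordinal n0).
Let D := 2 * W - 2 * e.
Hypotheses (ka0 : 0 <= ka) (D0 : 0 <= D) (cl : Sigma l c).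
Hypothesis u_odd : forall y, Sigma l y -> u (refl l y) = - u y.
Hypothesis u_le : forall y, Sigma l y -> al + hsum 0 y <= W - u y.
Hypothesis h_le : forall y, al + hsum 0 y <= e.
Hypothesis FE : forall y, F y = ka * (W - u y) * gprod 0 y.
Hypothesis mF : measurable_fun setT F.
Hypothesis tail :
  ((p * M0)%:E <= \int[mu]_z (\1_`]l, +oo[ z * gauss c0 a z)%:E)%E.

(** The reflection moves coordinate 0 only, so points are paired inside the innermost integral, with
    the other coordinates frozen in [x]. The function [g] is the barrier plus the bonus [D] beyond
    the hyperplane, times the kernel. *)
Lemma pairing_upd x z : z < l ->
  let g z := ka * gprod 1 x * (gauss c0 a z * (al + hsum 1 x +
    be (Ordinal n0) * (z - c0) - ga * (z - c0) ^+ 2 + D * \1_`]l, +oo[ z)) in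
  g z + g (2 * l - z) <= F (upd x 0 z) + F (upd x 0 (2 * l - z)).
Proof.
move=> zl; cbv zeta.
have Sz : Sigma l (upd x 0 z) by move=> i i0; rewrite /upd i0 eqxx.
have Ez : upd x 0 (2 * l - z) = refl l (upd x 0 z).
  by apply/funext => i; rewrite /refl /upd; case: ifP.
have c0l : c0 < l by exact: cl.
have h1 := u_le Sz; have h2 := h_le (upd x 0 z).
have h3 := h_le (upd x 0 (2 * l - z)).
rewrite !FE !(gprod_upd n0) Ez u_odd// !indicE.
rewrite memNset/= ?in_itv/=; last by rewrite andbT; lra.
rewrite mem_set/= ?in_itv/=; last by rewrite andbT; lra.
move: h1 h2 h3; rewrite !(hsum_upd n0) -/c0.
set e1 := gauss _ _ z; set e2 := gauss _ _ (2 * l - z).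
set hz := be _ * (z - c0) - _; set hz' := be _ * (2 * l - z - c0) - _.
set G := gprod 1 x; set U := u _; set h1 := hsum 1 x => h1U h2 h3.
have e20 : 0 <= e2 by exact/ltW/gauss_gt0.
(* The squared distances from [c0] to the two paired points differ by [4 * (l - c0) * (l - z)],
   which is nonnegative. *)
have e12 : e2 <= e1.
  rewrite ler_expR ler_pM2r; last by rewrite invr_gt0 mulr_gt0.
  have h : 0 <= (l - c0) * (l - z) by rewrite mulr_ge0 ?subr_ge0 ?ltW.
  by rewrite lerN2; nra.
have G0 : 0 <= ka * G by rewrite mulr_ge0// ltW// gprod_gt0.
(* Antisymmetry makes the reflected integrand [W + U]. With [D = 2 * W - 2 * e] the difference
   regroups into two nonnegative products: barrier gap times kernel gap, and [e2] times [2 * e]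
   minus the two barrier values. *)
rewrite -subr_ge0 (_ : _ - _ = ka * G * ((W - U - (al + (hz + h1))) * (e1 - e2) +
  e2 * (2 * e - (al + (hz + h1)) - (al + (hz' + h1))))); last first.
  by rewrite /D /hz /hz'; ring.
by rewrite mulr_ge0// addr_ge0// mulr_ge0//; lra.
Qed.

(** Induction on the number of integrated coordinates. Coordinate 0 is handled by pairing and
    produces the gain [D * p]; each coordinate contributes a factor of mass and a loss of
    [16 * a * ga]. *)
Lemma intRn_aux_lower k x : (k < n)%N ->
  (intRn_aux k.+1 (fun y => `|F y|%:E) x < +oo)%E ->
  ((ka * M0 ^+ k.+1 * gprod k.+1 x *
     (al - k.+1%:R * ga * (16 * a) + D * p + hsum k.+1 x))%:E <=
   intRn_aux k.+1 (fun y => (F y)%:E) x)%E.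
Proof.
elim: k x => [|k IH] x kn Foo.
  pose A := ka * gprod 1 x.
  have A0 : 0 <= A by rewrite mulr_ge0// ltW// gprod_gt0.
  have [ig lg] := gauss_poly_ge (al + hsum 1 x) (be (Ordinal n0)) a0 ga0 D0 tail.
  apply: (@le_trans _ _ (A%:E * (M0 * (al + hsum 1 x - ga * (16 * a) + D * p))%:E)%E).
    by rewrite -EFinM lee_fin le_eqVlt; apply/orP; left; apply/eqP; rewrite /A; ring.
  apply: le_trans (lee_wpmul2l _ lg) _; first by rewrite lee_fin.
  rewrite -integralZl//; under eq_integral do rewrite -EFinM.
  apply: (@le_integral_pairing _ l).
  - have mFu : measurable_fun setT (fun z : measurableTypeR R => F (upd x 0 z)).
      by apply: (measurableT_comp mF); exact: measurable_upd.
    by apply/integrableP; split => //; exact/measurable_EFinP.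
  - have -> : EFin \o (fun z => A * (gauss c0 a z * (al + hsum 1 x +
      be (Ordinal n0) * (z - c0) - ga * (z - c0) ^+ 2 + D * \1_`]l, +oo[ z))) =
      (fun z => A%:E * (gauss c0 a z * (al + hsum 1 x +
      be (Ordinal n0) * (z - c0) - ga * (z - c0) ^+ 2 + D * \1_`]l, +oo[ z))%:E)%E.
      by apply/funext => z; rewrite /= EFinM.
    exact: integrableZl.
  - by move=> z zl; exact: pairing_upd.
pose c1 := c (Ordinal kn).
pose A := ka * M0 ^+ k.+1 * gprod k.+2 x.
pose B := al - k.+1%:R * ga * (16 * a) + D * p + hsum k.+2 x.
have A0 : 0 <= A.
  by rewrite !mulr_ge0// ?exprn_ge0 ?sqrtr_ge0// ltW// gprod_gt0.
(* The later coordinates carry no bonus: the one-dimensional estimate is reused with [D] and [p]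
   both zero. *)
have tail0 : ((0 * M0)%:E <= \int[mu]_z (\1_`]l, +oo[ z * gauss c1 a z)%:E)%E.
  rewrite mul0r; apply: integral_ge0 => z _.
  by rewrite lee_fin; apply: mulr_ge0 => //; exact/ltW/gauss_gt0.
have [ig lg] := gauss_poly_ge B (be (Ordinal kn)) a0 ga0 (lexx 0) tail0.
apply: (@le_trans _ _ (A%:E * (M0 * (B - ga * (16 * a) + 0 * 0))%:E)%E).
  rewrite -EFinM lee_fin le_eqVlt; apply/orP; left; apply/eqP.
  by rewrite /A /B -[k.+2%:R]natr1 exprS; ring.
apply: le_trans (lee_wpmul2l _ lg) _; first by rewrite lee_fin.
rewrite -integralZl//.
(* The induction hypothesis needs a slice with finite absolute integral, hence holds for almost
   every [z]. *)
apply: ae_le_integral.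
  by apply: (@measurable_int _ _ _ mu); exact: integrableZl.
have mabs : measurable_fun setT (fun y : mpt R n => `|F y|%:E).
  by apply/measurable_EFinP; exact: measurableT_comp.
apply: (@filterS _ _ (ae_filter_ringOfSetsType mu) _ _ _
  (ae_intRn_aux_lty mabs (fun y => _) Foo)) => [z zoo|y]; last by rewrite lee_fin.
apply: le_trans (IH _ (ltnW kn) zoo).
rewrite (gprod_upd kn) (hsum_upd kn) -EFinM lee_fin le_eqVlt.
by apply/orP; left; apply/eqP; rewrite /A /B -/c1; ring.
Qed.

End gaussian_lower_bound.

(** * Power integrals and positivity of the normalising constant *)

Section power_integrals.
Context {R : realType}.
Local Notation mu := (@lebesgue_measure R).
Implicit Types s T z : R.

Lemma powRN_le s z z' : 0 <= s -> 0 < z -> z <= z' -> z' `^ (- s) <= z `^ (- s).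
Proof.
move=> s0 z0 zz'; rewrite !powRN lef_pV2 ?posrE ?powR_gt0//; last lra.
by rewrite ge0_ler_powR// ?nnegrE; lra.
Qed.

Lemma integral_powR_itv_le s (d T : R) : s < 1 -> 0 < d -> d < T ->
  (\int[mu]_(z in `[d, T]) (z `^ (- s))%:E <= (T `^ (1 - s) / (1 - s))%:E)%E.
Proof.
move=> s1 d0 dT; pose F z := (1 - s)^-1 * z `^ (1 - s).
have dF z : 0 < z -> is_derive z 1 F (z `^ (- s)).
  move=> z0; have h := @is_deriveZ _ _ _ _ (1 - s)^-1 _ _ _ (is_derive1_powR (1 - s) z0).
  apply: (is_derive_eq h); rewrite /GRing.scale/= mulrA mulVf ?mul1r.
    by congr (_ `^ _); ring.
  by rewrite gt_eqF//; lra.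
have cF z : 0 < z -> {for z, continuous F}.
  by move=> /dF [dz _]; apply: differentiable_continuous; apply/derivable1_diffP.
rewrite (@continuous_FTC2 _ (fun z => z `^ (- s)) F)//.
- rewrite -EFinB lee_fin /F mulrC lerBlDr lerDl.
  by rewrite mulr_ge0 ?powR_ge0// invr_ge0; lra.
- apply: derivable_within_continuous => z; rewrite in_itv/= => /andP[dz _].
  by apply: derivable_powR; rewrite in_itv/= andbT; lra.
- split.
  + move=> z; rewrite in_itv/= => /andP[dz _].
    by have [|//] := dF z; lra.
  + by apply: cvg_at_right_filter; apply: cF.
  + by apply: cvg_at_left_filter; apply: cF; lra.
- move=> z; rewrite in_itv/= => /andP[dz _].
  by rewrite derive1E; apply: derive_val; apply: dF; lra.
Qed.

(** To avoid the singularity at 0, the bound is taken on [[T / m.+2, T]] and passed to the limit by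
    monotone convergence. The offset 2 keeps the left endpoint strictly below [T] for [m = 0]. *)
Lemma integral_powR_le s T : s < 1 -> 0 < T ->
  (\int[mu]_(z in `]0%R, T]) (z `^ (- s))%:E <= (T `^ (1 - s) / (1 - s))%:E)%E.
Proof.
move=> s1 T0; pose F (m : nat) := `[T / m.+2%:R, T]%classic.
have -> : `]0, T]%classic = \bigcup_m F m.
  apply/seteqP; split => [z/=|z [m _]]; rewrite /F/= !in_itv/= => /andP[z0 zT].
    exists (Num.truncn (T / z)) => //=; rewrite in_itv/= zT andbT.
    rewrite ler_pdivrMr// mulrC -ler_pdivrMr//.
    by apply: le_trans (ltW (truncnS_gt _)) _; rewrite ler_nat.
  by rewrite zT andbT; apply: lt_le_trans z0; rewrite divr_gt0.
have mf (D : set R) : measurable_fun D (fun z => (z `^ (- s))%:E).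
  by apply: measurable_funTS; apply/measurable_EFinP; exact: measurable_powR.
have cv := @ge0_nondecreasing_set_cvg_integral _ (measurableTypeR R) R F
  (fun z => (z `^ (- s))%:E) mu.
apply: (cvge_to_le (cv _ _ _ _)) => //.
- apply/nondecreasing_seqP => m; rewrite subsetEset => z; rewrite /F/= !in_itv/=.
  move=> /andP[mz ->]; rewrite andbT; apply: le_trans mz.
  by rewrite ler_pM2l// lef_pV2 ?posrE// ler_nat.
- by move=> m; exact: measurable_itv.
- by move=> m; exact: mf.
- by move=> m z _; rewrite lee_fin powR_ge0.
- apply: nearW => m; apply: integral_powR_itv_le => //; first by rewrite divr_gt0.
  by rewrite ltr_pdivrMr// -[ltLHS]mulr1 ltr_pM2l// ltr1n.
Qed.

Lemma integral_Gamma_lty s : 0 < s < 1 ->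
  (\int[mu]_(z in `]0%R, +oo[) (z `^ (1 - s - 1) * expR (- z))%:E < +oo)%E.
Proof.
move=> /andP[s0 s1].
have mp : measurable_fun setT (fun z : R => (z `^ (- s))%:E).
  by apply/measurable_EFinP; exact: measurable_powR.
pose f z := ((fun z : R => (z `^ (- s))%:E) \_ `]0, 1]) z.
have mf : measurable_fun setT f.
  by apply/(measurable_restrictT _ _).1 => //; exact: measurable_funTS.
have f0 z : (0 <= f z)%E.
  by rewrite /f patchE; case: ifP => // _; rewrite lee_fin powR_ge0.
have me : measurable_fun setT (fun z => (exponential_pdf (1 : R) z)%:E).
  by apply/measurable_EFinP; exact: measurable_exponential_pdf.
apply: (@le_lt_trans _ _ (\int[mu]_z (f z + (exponential_pdf 1 z)%:E))%E); last first.
  rewrite ge0_integralD//; last by move=> z _; rewrite lee_fin exponential_pdf_ge0.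
  rewrite integral_exponential_pdf// lte_add_pinfty// ?ltry//.
  rewrite /f -integral_mkcond; apply: le_lt_trans (ltry _).
  exact: integral_powR_le.
rewrite integral_mkcond; apply: le_integral_ge0 => z.
  rewrite patchE; case: ifP => // _.
  by rewrite lee_fin mulr_ge0// ?powR_ge0 ?expR_ge0.
have e0 : 0 <= exponential_pdf 1 z by exact: exponential_pdf_ge0.
rewrite patchE; case: ifPn => [/set_mem/=|_]; last by rewrite adde_ge0// lee_fin.
rewrite in_itv/= andbT => z0.
have -> : 1 - s - 1 = - s by ring.
have [z1|z1] := leP z 1.
  rewrite /f patchE mem_set/=; last by rewrite in_itv/= z0 z1.
  rewrite -EFinD lee_fin ler_wpDr// -[leRHS]mulr1 ler_wpM2l ?powR_ge0//.
  by rewrite -[leRHS]expR0 ler_expR; lra.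
rewrite -[leLHS]add0e; apply: leeD => //.
rewrite exponential_pdfE; last exact: ltW.
rewrite lee_fin mul1r mulN1r -[leRHS]mul1r.
rewrite ler_wpM2r ?expR_ge0//.
have -> : 1 = 1 `^ (- s) :> R by rewrite powR1.
by apply: powRN_le; lra.
Qed.

Lemma integral_Gamma_gt0 s : 0 < s < 1 ->
  (0 < \int[mu]_(z in `]0%R, +oo[) (z `^ (1 - s - 1) * expR (- z))%:E)%E.
Proof.
move=> /andP[s0 s1].
pose k : R := 2 `^ (- s) * expR (- 2).
have k0 : 0 < k by rewrite mulr_gt0 ?powR_gt0 ?expR_gt0.
apply: (@lt_le_trans _ _ (\int[mu]_z (k%:E * (\1_(`]1, 2] : set R) z)%:E)%E)%E).
  rewrite ge0_integralZl//; last exact: ltW.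
    rewrite integral_indic//= setIT lebesgue_measure_itv/= lte_fin ifT; last lra.
    by rewrite -EFinB -EFinM lte_fin mulr_gt0//; lra.
  by apply/measurable_EFinP; exact: measurable_indic.
rewrite [leRHS]integral_mkcond; apply: le_integral_ge0 => z.
  by rewrite -EFinM lee_fin mulr_ge0// ltW.
rewrite -EFinM indicE.
have [/set_mem/=|_] := boolP (z \in _); last first.
  rewrite mulr0 patchE; case: ifP => // _.
  by rewrite lee_fin mulr_ge0// ?powR_ge0 ?expR_ge0.
rewrite in_itv/= => /andP[z1 z2].
rewrite patchE mem_set/= ?in_itv/= ?andbT; last lra.
rewrite mulr1 lee_fin /k; have -> : 1 - s - 1 = - s by ring.
apply: ler_pM; rewrite ?powR_ge0 ?expR_ge0 ?ler_expR ?lerN2//.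
by apply: powRN_le; lra.
Qed.

Lemma Cns_gt0 n s : 0 < s < 1 -> 0 < Cns n s.
Proof.
move=> s01; have /andP[s0 s1] := s01.
have G0 : 0 < Gamma (1 - s).
  by apply: fine_gt0; rewrite integral_Gamma_gt0// integral_Gamma_lty.
rewrite /Cns mul1r invr_gt0 mulr_gt0//.
  by rewrite powR_gt0// mulr_gt0// pi_gt0.
rewrite normr_gt0 /GammaNeg mulf_neq0//; first by rewrite gt_eqF.
by rewrite invr_eq0 oppr_eq0 gt_eqF.
Qed.

End power_integrals.

(** * Semicontinuity: measurability and attained maxima *)

Section semicontinuity.
Variables (R : realType) (n : nat).
Implicit Types (x y : pt R n) (t tau d l : R).

Lemma pdist_lt x t y tau (b d : R) : 0 <= b ->
  (forall i, `|x i - y i| <= b) -> `|t - tau| <= b -> n.+1%:R * b < d ->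
  pdist x t y tau < d.
Proof.
move=> b0 hx ht hd.
have d0 : 0 < d by apply: le_lt_trans hd; rewrite mulr_ge0.
have sqle z : `|z| <= b -> z ^+ 2 <= b ^+ 2.
  by move=> zb; rewrite -real_normK ?num_real// lerXn2r ?nnegrE.
rewrite /pdist -[ltRHS]gtr0_norm// -sqrtr_sqr ltr_sqrt ?exprn_gt0//.
apply: (@le_lt_trans _ _ (n.+1%:R * b ^+ 2)).
  rewrite -natr1 mulrDl mul1r lerD// ?sqle//.
  apply: (@le_trans _ _ (\sum_(i < n) b ^+ 2)).
    by apply: ler_sum => i _; exact: sqle.
  by rewrite sumr_const card_ord mulr_natl.
apply: (@le_lt_trans _ _ ((n.+1%:R * b) ^+ 2)).
  rewrite exprMn ler_wpM2r ?sqr_ge0//.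
  by rewrite -[leLHS]mulr1 expr2 ler_wpM2l// ler1n.
by rewrite ltrXn2r ?nnegrE ?mulr_ge0// ltW.
Qed.

(** A set that is open relative to [B] is the trace on [B] of a countable union of rational boxes,
    and boxes are measurable. *)
Lemma measurable_pdist_open (B S : set (mpt R n * measurableTypeR R)) :
  measurable B -> S `<=` B ->
  (forall p, S p -> exists d, 0 < d /\
     forall q, B q -> pdist q.1 q.2 p.1 p.2 < d -> S q) ->
  measurable S.
Proof.
move=> mB SB hS.
pose box (k : {ffun 'I_n -> rat} * (rat * rat)) : set (mpt R n * measurableTypeR R) :=
  [set q | (forall i, `|q.1 i - ratr (k.1 i)| < ratr k.2.2) /\
           `|q.2 - ratr k.2.1| < ratr k.2.2].
have mlt (f : mpt R n * measurableTypeR R -> R) b :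
    measurable_fun setT f -> measurable [set q | f q < b].
  move=> mf; have := mf measurableT `]-oo, b[%classic (measurable_itv _).
  by rewrite setTI; congr measurable; apply/seteqP; split => q; rewrite /= in_itv.
have mbox k : measurable (box k).
  have -> : box k = \bigcap_(i in [set: 'I_n])
      [set q : mpt R n * measurableTypeR R | `|q.1 i - ratr (k.1 i)| < ratr k.2.2]
      `&` [set q | `|q.2 - ratr k.2.1| < ratr k.2.2].
    by apply/seteqP; split => q [q1 q2]; split => // i; [move=> _; exact: q1|exact: q1].
  apply: measurableI; [apply: fin_bigcap_measurable => // i _|]; apply: mlt.
    apply: measurableT_comp => //; apply: measurable_funB => //.
    by apply: (measurableT_comp (measurable_coord i)); exact: measurable_fst.
  apply: measurableT_comp => //; apply: measurable_funB => //.
have -> : S = B `&` \bigcup_k [set p | box k p /\ box k `&` B `<=` S].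
  apply/seteqP; split => [p Sp|p [Bp [k _ [kp kS]]]]; last exact: kS.
  split; first exact: SB.
  have [d [d0 hd]] := hS p Sp.
  (* Two points of a box of half-width [e] differ by less than [2 * e] in each of the [n.+1]
     coordinates, so [pdist] stays below [d]. *)
  have d1 : 0 < d / (2 * n.+1%:R) by rewrite divr_gt0// mulr_gt0.
  have [e /[!in_itv]/= /andP[e0 ed]] := rat_in_itvoo d1.
  have app (z : R) : exists r : rat, `|z - ratr r| < ratr e.
    have [r /[!in_itv]/= /andP[r1 r2]] := @rat_in_itvoo R (z - ratr e) (z + ratr e) ltac:(lra).
    by exists r; rewrite ltr_norml; apply/andP; split; lra.
  have [rf hrf] := choice (fun i : 'I_n => app (p.1 i)).
  have [rt hrt] := app p.2.
  exists ([ffun i => rf i], (rt, e)) => //=; split; first by split => // i; rewrite /= ffunE.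
  move=> q [[q1 q2] Bq]; apply: hd => //.
  apply: (@pdist_lt _ _ _ _ (2 * ratr e)); first lra.
  - move=> i; have := q1 i; have := hrf i; rewrite /= ffunE => h1 h2.
    rewrite -[q.1 i](subrK (ratr (rf i))) -addrA.
    apply: le_trans (ler_normD _ _) _; rewrite distrC in h1; lra.
  - rewrite /= in q2; rewrite -[q.2](subrK (ratr rt)) -addrA.
    apply: le_trans (ler_normD _ _) _; rewrite distrC in hrt; lra.
  - move: ed; rewrite ltr_pdivlMr ?mulr_gt0// => ed.
    by apply: le_lt_trans ed; rewrite le_eqVlt; apply/orP; left; apply/eqP; ring.
apply: measurableI => //; apply: countable_bigcupT_measurable; first exact: countableP.
move=> k; have [kS|kS] := pselect (box k `&` B `<=` S).
  rewrite (_ : [set _ | _] = box k)//.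
  by apply/seteqP; split => [q []|q].
rewrite (_ : [set _ | _] = set0)//.
by apply/seteqP; split => [q []|q].
Qed.

(** On the closed half-space the sets [w < b] are relatively open by semicontinuity; on the
    complement [w] is minus its value at the reflected point. *)
Lemma measurable_antisymmetric_usc l (w : pt R n -> R -> R) : (0 < n)%N ->
  (forall x t, SigmaBar l x -> forall e : R, 0 < e -> exists d : R, 0 < d /\
     forall y tau, SigmaBar l y -> pdist y tau x t < d -> w y tau < w x t + e) ->
  (forall x t, Sigma l x -> w x t = - w (refl l x) t) ->
  measurable_fun setT (fun p : mpt R n * measurableTypeR R => w p.1 p.2).
Proof.
move=> n0 usc odd; pose i0 := Ordinal n0.
have vi0 (i : 'I_n) : val i = 0%N -> i = i0 by move=> h; exact: val_inj.
have SBE y : SigmaBar l y <-> y i0 <= l.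
  by split => [|yl i /vi0 ->//]; apply.
pose B : set (mpt R n * measurableTypeR R) := [set p | p.1 i0 <= l].
have mp : measurable_fun setT (fun p : mpt R n * measurableTypeR R => p.1 i0).
  by apply: (measurableT_comp (measurable_coord i0)); exact: measurable_fst.
have mB : measurable B.
  have := mp measurableT `]-oo, l]%classic (measurable_itv _).
  by rewrite setTI; congr measurable; apply/seteqP; split => q; rewrite /= in_itv.
have mwB : measurable_fun B (fun p => w p.1 p.2).
  apply: (measurability _ (RGenInftyO.measurableE R)) => _ [_ [b ->] <-].
  apply: (@measurable_pdist_open B) => [//|p []//|p [Bp]].
  rewrite /= in_itv/= => wb.
  have e0 : 0 < b - w p.1 p.2 by lra.
  have [d [d0 hd]] := usc p.1 p.2 ((SBE _).2 Bp) _ e0.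
  exists d; split => // q Bq qd; split => //=; rewrite in_itv/=.
  by have := hd q.1 q.2 ((SBE _).2 Bq) qd; lra.
have -> : (fun p : mpt R n * measurableTypeR R => w p.1 p.2) =
    (fun p => if p.1 i0 <= l then w p.1 p.2 else - w (refl l p.1) p.2).
  apply/funext => p; case: leP => // pl.
  have Sr : Sigma l (refl l p.1).
    by move=> i /vi0 ->; rewrite /refl/=; lra.
  rewrite (odd _ p.2 Sr) opprK; congr (w _ _); apply/funext => i.
  by rewrite /refl; case: (\val i == 0%N); rewrite ?subKr.
apply: (@measurable_fun_if _ _ _ _ (fun p : mpt R n * measurableTypeR R => w p.1 p.2)) => //.
- exact: measurable_fun_ler.
- exact: measurable_funS mwB.
- apply: measurableT_comp => //.
  apply: (@measurable_comp _ _ _ _ _ _ B (fun p => w p.1 p.2) _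
    (fun p : mpt R n * measurableTypeR R => (refl l p.1 : mpt R n, p.2))) => //.
    by move=> _ [p [_ /= /negbT pl] <-]; rewrite /B/= /refl/=; lra.
  apply: measurable_funTS; apply: measurable_fun_pair => //.
  by apply: measurable_refl; exact: measurable_fst.
Qed.

Lemma near_pdist (p : 'rV[R]_n * R) d : 0 < d ->
  \forall q \near p, pdist ((q.1 : 'rV[R]_n) ord0) q.2 (p.1 ord0) p.2 < d.
Proof.
move=> d0; have e0 : 0 < d / (2 * n.+1%:R) by rewrite divr_gt0// mulr_gt0.
apply/nbhs_ballP; exists (d / (2 * n.+1%:R)) => //= q [q1 q2].
apply: (@pdist_lt _ _ _ _ (d / (2 * n.+1%:R))); first exact: ltW.
- by move=> i; rewrite distrC; apply: ltW; case: q1 => _; exact.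
- by rewrite distrC; apply: ltW; exact: q2.
- rewrite (_ : _ * _ = d / 2); first by lra.
  by field; rewrite ?pnatr_eq0.
Qed.

(** If the supremum [m] were not attained, every point would have a neighbourhood where [f < i] for
    all [i] close to [m] from the left. By compactness a single [i < m] would bound [f] on [K]. *)
Lemma usc_compact_max (T : topologicalType) (K : set T) (f : T -> R) (M : R) :
  compact K -> K !=set0 -> (forall p, K p -> f p <= M) ->
  (forall p, K p -> forall e, 0 < e -> \forall q \near p, K q -> f q < f p + e) ->
  exists2 p, K p & forall q, K q -> f q <= f p.
Proof.
move=> cK K0 fM usc; pose m := sup (f @` K).
have fK0 : (f @` K) !=set0 by case: K0 => p Kp; exists (f p); exists p.
have ubm : has_ubound (f @` K) by exists M => _ [p Kp <-]; exact: fM.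
have fm p : K p -> f p <= m by move=> Kp; apply: ub_le_sup => //; exists p.
apply: contrapT => nomax.
have fltm p : K p -> f p < m.
  move=> Kp; rewrite lt_neqAle fm// andbT; apply/negP => /eqP fpm.
  by apply: nomax; exists p => // q Kq; rewrite fpm fm.
have cov := (near_covering_withinP K).2 ((compact_near_coveringP K).1 cK).
have Km : \forall i \near m^'-, K `<=` (fun p => f p < i).
  apply: (cov _ _ (fun i p => f p < i)) => p Kp.
  have fpm := fltm p Kp; have e0 : 0 < (m - f p) / 2 by lra.
  exists ((fun q => K q -> f q < f p + (m - f p) / 2), [set i | (f p + m) / 2 < i]).
    split => /=; first exact: usc.
    by apply: nbhs_left_gt; lra.
  move=> [q i] /= [hq hi] Kq.
  by apply: lt_trans (hq Kq) _; lra.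
have [i [Ki im]] : exists i, (K `<=` (fun p => f p < i)) /\ i < m.
  by near m^'- => i; exists i; split; near: i => //; exact: nbhs_left_lt.
suff : m <= i by rewrite leNgt im.
by apply: ge_sup => // _ [p Kp <-]; apply: ltW; exact: Ki.
Unshelve. all: by end_near. Qed.

End semicontinuity.

(** * The bump and the maximum point of the perturbed function *)

Section perturbed_maximum.
Variables (R : realType) (n : nat) (x0 : pt R n) (t0 rho : R).
Hypothesis rho0 : 0 < rho.

Definition bump (x : pt R n) (t : R) : R :=
  1 - (\sum_i (x i - x0 i) ^+ 2) / rho ^+ 2 - (t - t0) ^+ 2 / rho ^+ 4.

Lemma bump_le1 x t : bump x t <= 1.
Proof.
rewrite /bump; set u := _ / rho ^+ 2; set v := _ / rho ^+ 4.
suff : 0 <= u /\ 0 <= v by move=> [? ?]; lra.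
have r0 k : 0 <= rho ^+ k by rewrite exprn_ge0// ltW.
split; apply: divr_ge0 => //; last exact: sqr_ge0.
by apply: sumr_ge0 => i _; exact: sqr_ge0.
Qed.

Lemma bump_ge0 x t : 0 <= bump x t ->
  (forall i, `|x i - x0 i| <= rho) /\ `|t - t0| <= rho ^+ 2.
Proof.
rewrite /bump; set u := _ / rho ^+ 2; set v := _ / rho ^+ 4 => uv.
have S0 : 0 <= \sum_i (x i - x0 i) ^+ 2.
  by apply: sumr_ge0 => i _; exact: sqr_ge0.
have u0 : 0 <= u by rewrite divr_ge0// ?exprn_ge0 ?ltW.
have v0 : 0 <= v by rewrite divr_ge0 ?sqr_ge0 ?exprn_ge0 ?ltW.
have sqrle (z r : R) : 0 <= r -> z ^+ 2 <= r ^+ 2 -> `|z| <= r.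
  by move=> r0; rewrite -[z ^+ 2]real_normK ?num_real// ler_pXn2r ?nnegrE.
split.
  move=> i; apply: sqrle; first exact: ltW.
  have : u <= 1 by lra.
  rewrite ler_pdivrMr ?exprn_gt0// mul1r; apply: le_trans.
  rewrite (bigD1 i)//= lerDl; apply: sumr_ge0 => j _; exact: sqr_ge0.
apply: sqrle; first exact: sqr_ge0.
have : v <= 1 by lra.
by rewrite ler_pdivrMr ?exprn_gt0// mul1r -exprM.
Qed.

Lemma bump_center : bump x0 t0 = 1.
Proof.
rewrite /bump big1 ?mul0r ?subrr ?expr0n/= ?mul0r ?subr0//.
by move=> i _; rewrite subrr expr0n.
Qed.

Lemma continuous_bump :
  continuous (fun p : 'rV[R]_n * R => bump (p.1 ord0) p.2).
Proof.
move=> p; rewrite /bump; apply: cvgB; [apply: cvgB; first exact: cvg_cst|].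
- apply: cvgM; last exact: cvg_cst.
  pose g (i : 'I_n) (q : 'rV[R]_n * R) := (q.1 ord0 i - x0 i) ^+ 2.
  suff cg (i : 'I_n) : g i q @[q --> p] --> g i p.
    rewrite (_ : (fun q : 'rV[R]_n * R => _) = \sum_i g i); last first.
      by apply/funext => q; rewrite fct_sumE.
    rewrite (_ : \sum_i (_ : R) = (\sum_i g i) p); last by rewrite fct_sumE.
    elim/big_ind: _ => [|g1 g2 c1 c2|i _]; [exact: cvg_cst|exact: cvgD|exact: cg].
  have ci : (fun q : 'rV[R]_n * R => q.1 ord0 i - x0 i) q @[q --> p] -->
      p.1 ord0 i - x0 i.
    apply: cvgB; last exact: cvg_cst.
    apply: (@cvg_comp _ _ _ fst (fun v : 'rV[R]_n => v ord0 i) _ (nbhs p.1)).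
      exact: cvg_fst.
    exact: coord_continuous.
  exact: cvgM.
- apply: cvgM; last exact: cvg_cst.
  have ct : (fun q : 'rV[R]_n * R => q.2 - t0) q @[q --> p] --> p.2 - t0.
    by apply: cvgB; [exact: cvg_snd|exact: cvg_cst].
  exact: cvgM.
Qed.

(** The maximum is taken over a compact box inside the half-space that contains all points where the
    bump is nonnegative. Its value exceeds [A], the centre already giving more, and [w <= A] then
    forces the bump to be positive there. *)
Lemma perturbed_maximum (w : pt R n -> R -> R) (l A eps : R) (i0 : 'I_n) :
  val i0 = 0%N ->
  (forall x t, SigmaBar l x -> forall e : R, 0 < e -> exists d : R, 0 < d /\
     forall y tau, SigmaBar l y -> pdist y tau x t < d -> w y tau < w x t + e) ->
  (forall x t, Sigma l x -> w x t <= A) ->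
  x0 i0 + rho < l -> 0 < eps -> A - eps < w x0 t0 ->
  exists xb tb, [/\ Sigma l xb, 0 < bump xb tb, A - eps < w xb tb &
    forall y tau, Sigma l y ->
      eps * (bump y tau - bump xb tb) <= w xb tb - w y tau /\
      - eps <= w xb tb - w y tau].
Proof.
move=> vi0 usc wA x0l eps0 w0.
pose K : set ('rV[R]_n * R) :=
  [set v : 'rV[R]_n | forall i, `[x0 i - rho, x0 i + rho]%classic (v ord0 i)]
  `*` `[t0 - rho ^+ 2, t0 + rho ^+ 2].
have KE (p : 'rV[R]_n * R) : K p <->
    (forall i, `|p.1 ord0 i - x0 i| <= rho) /\ `|p.2 - t0| <= rho ^+ 2.
  split => [[/= h1 h2]|[h1 h2]].
    split => [i|]; first by have := h1 i; rewrite /= in_itv/= ler_distl.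
    by move: h2; rewrite in_itv/= ler_distl.
  by split => [i|] /=; rewrite in_itv/= -ler_distl.
have KS p : K p -> Sigma l (p.1 ord0).
  move=> /KE[h _] i iE; have -> : i = i0 by apply: val_inj; rewrite vi0.
  by have := h i0; rewrite ler_norml => /andP[_]; lra.
have SB (x : pt R n) : Sigma l x -> SigmaBar l x by move=> h i /h /ltW.
have cK : compact K.
  apply: compact_setX; last exact: segment_compact.
  apply: (@rV_compact _ _ (fun i => `[x0 i - rho, x0 i + rho]%classic)) => i.
  exact: segment_compact.
pose f (p : 'rV[R]_n * R) := w (p.1 ord0) p.2 + eps * bump (p.1 ord0) p.2.
have rowE (x : pt R n) : (\row_i x i) ord0 = x by apply/funext => i; rewrite mxE.
have K0 : K (\row_i x0 i, t0).
  apply/KE; split => [i|]; rewrite /= ?mxE subrr normr0 ?sqr_ge0//.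
  exact: ltW.
have [|p Kp|p Kp e e0|[xb tb] Kb fmax] := @usc_compact_max R _ K f (A + eps) cK.
- by exists (\row_i x0 i, t0).
- rewrite /f lerD ?wA//; first exact: KS.
  by rewrite -[leRHS]mulr1 ler_pM2l// bump_le1.
- have e2 : 0 < e / 2 by lra.
  have e3 : 0 < e / (2 * eps) by rewrite divr_gt0// mulr_gt0.
  have [d [d0 hd]] := usc (p.1 ord0) p.2 (@SB (p.1 ord0) (@KS p Kp)) _ e2.
  have cb : \forall q \near p, bump ((q.1 : 'rV[R]_n) ord0) q.2 < bump (p.1 ord0) p.2 + e / (2 * eps).
    move/cvgrPdist_lt: (@continuous_bump p) => /(_ _ e3).
    by apply: filterS => q; rewrite ltr_norml => /andP[+ _]; lra.
  near=> q => Kq.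
  have h1 : w (q.1 ord0) q.2 < w (p.1 ord0) p.2 + e / 2.
    apply: hd; first exact/SB/KS.
    by near: q; exact: near_pdist.
  have h2 : bump (q.1 ord0) q.2 < bump (p.1 ord0) p.2 + e / (2 * eps) by near: q.
  have h3 : (bump (q.1 ord0) q.2 - bump (p.1 ord0) p.2) * (2 * eps) < e.
    by rewrite -ltr_pdivlMr ?mulr_gt0//; lra.
  by rewrite /f; lra.
have Sb := KS _ Kb; rewrite /= in Sb.
exists (xb ord0), tb.
have m0 : w x0 t0 + eps <= w (xb ord0) tb + eps * bump (xb ord0) tb.
  by have := fmax _ K0; rewrite /f/= rowE bump_center mulr1.
have b1 := bump_le1 (xb ord0) tb.
have wbA := wA (xb ord0) tb Sb.
have eb1 : eps * bump (xb ord0) tb <= eps by rewrite -[leRHS]mulr1 ler_pM2l.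
have b0 : 0 < bump (xb ord0) tb by rewrite -(pmulr_rgt0 _ eps0); lra.
split => //; first lra.
move=> y tau Sy; have wyA := wA y tau Sy.
(* Where the bump is nonnegative the point lies in the box. Elsewhere [w y tau <= A] already lies
   below the maximal value, and the negative bump only helps. *)
have [by0|by0] := leP 0 (bump y tau).
  have eby : 0 <= eps * bump y tau by rewrite mulr_ge0// ltW.
  have : w y tau + eps * bump y tau <= w (xb ord0) tb + eps * bump (xb ord0) tb.
    have Ky : K (\row_i y i, tau).
      by apply/KE; have [h1 h2] := bump_ge0 by0; split => // i; rewrite /= mxE.
    by have := fmax _ Ky; rewrite /f/= rowE.
  by move=> h; split; lra.
have eby : eps * bump y tau < 0 by rewrite pmulr_rlt0.
by split; lra.
Unshelve. all: by end_near. Qed.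

End perturbed_maximum.

(** * The principal value at a fixed earlier time *)

Section inner_integral.
Variables (R : realType) (n : nat).
Local Notation mu := (@lebesgue_measure R).

Lemma enorm_ge0 (x : pt R n) : 0 <= enorm x.
Proof. exact: sqrtr_ge0. Qed.

Lemma sqr_enorm (x : pt R n) : enorm x ^+ 2 = \sum_i x i ^+ 2.
Proof. by rewrite sqr_sqrtr//; apply: sumr_ge0 => i _; exact: sqr_ge0. Qed.

Lemma measurable_sqr_enorm : measurable_fun setT (fun x : mpt R n => enorm x ^+ 2).
Proof.
rewrite (_ : (fun x => _) = fun x : mpt R n => \sum_(i <- enum 'I_n) x i ^+ 2); last first.
  by apply/funext => x; rewrite sqr_enorm big_enum.
by apply: measurable_sum => i; apply: measurable_funX; exact: measurable_coord.
Qed.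

Lemma measurable_enorm_psub (c : pt R n) :
  measurable_fun setT (fun x : mpt R n => enorm (psub c x)).
Proof.
rewrite (_ : (fun x => _) = fun x : mpt R n =>
    Num.sqrt (\sum_(i <- enum 'I_n) (c i - x i) ^+ 2)); last first.
  by apply/funext => x; rewrite /enorm big_enum.
apply: (measurableT_comp (continuous_measurable_fun (@sqrt_continuous R))).
apply: measurable_sum => i; apply: measurable_funX; apply: measurable_funB => //.
exact: measurable_coord.
Qed.

Lemma measurable_punctured (c : pt R n) (d : R) :
  measurable [set z : mpt R n | d < enorm (psub c z)].
Proof.
have := measurable_enorm_psub c measurableT (measurable_itv `]d, +oo[).
by rewrite setTI; congr measurable; apply/seteqP; split => z;
  rewrite /= in_itv/= andbT.
Qed.

(** In the innermost integral the puncture can affect only the value [z = c 0], a null set. *)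
Lemma intRn_punctured (c : pt R n) (F : mpt R n -> R) : (0 < n)%N ->
  measurable_fun setT F ->
  intRn (fun y => (F y * \1_[set z : pt R n | 0 < enorm (psub c z)] y)%:E) =
  intRn (fun y => (F y)%:E).
Proof.
move=> n0 mF; rewrite /intRn; move: (fun _ => 0) => x.
suff H k : (0 < k)%N -> forall x,
    intRn_aux k (fun y => (F y * \1_[set z : pt R n | 0 < enorm (psub c z)] y)%:E) x =
    intRn_aux k (fun y => (F y)%:E) x by exact: H.
case: k => // k _ {}x.
have mF0 : measurable_fun setT
    (fun y : mpt R n => F y * \1_[set z : pt R n | 0 < enorm (psub c z)] y).
  by apply: measurable_funM => //; apply: measurable_indic; exact: measurable_punctured.
elim: k x => [|k IH] x; last by apply: eq_integral => z _; exact: IH.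
have mu0 (f : mpt R n -> R) : measurable_fun setT f ->
    measurable_fun setT (fun z : measurableTypeR R => (f (upd x 0 z))%:E).
  move=> mf; apply/measurable_EFinP; apply: (measurableT_comp mf).
  exact: measurable_upd.
apply: ae_eq_integral => //; [exact: (mu0 _ mF0)|exact: (mu0 _ mF)|].
exists [set c (Ordinal n0)]; split => //; first exact: lebesgue_measure_set1.
move=> z /= h; apply: contrapT => zc; apply: h => _.
rewrite indicE mem_set ?mulr1//=.
rewrite lt_neqAle enorm_ge0 andbT eq_sym; apply/negP => /eqP e0.
have := sqr_enorm (psub c (upd x 0 z)); rewrite e0 expr0n/= => /esym/eqP.
rewrite psumr_eq0; last by move=> i _; exact: sqr_ge0.
move=> /allP/(_ (Ordinal n0) (mem_index_enum _))/=.
by rewrite /psub /upd/= sqrf_eq0 subr_eq0 => /eqP cz; exact: zc.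
Qed.

Variables (c : pt R n) (a P W : R) (u : mpt R n -> R).
Hypotheses (n0 : (0 < n)%N) (a0 : 0 < a) (mu_ : measurable_fun setT u).
Let ka := (a `^ P)^-1.
Let F (y : mpt R n) : R := ka * (W - u y) * gprod c a 0 y.

Lemma measurable_integrand : measurable_fun setT F.
Proof.
by apply: measurable_funM; [apply: measurable_funM => //; exact: measurable_funB|
  exact: measurable_gprod].
Qed.

Lemma intRn_integrand_fin_num : (intRn (fun y => `|F y|%:E) < +oo)%E ->
  exists r : R, intRn (fun y => (F y)%:E) = r%:E.
Proof.
move=> Foo; exists (fine (intRn (fun y => (F y)%:E))); rewrite fineK//.
have mF := measurable_integrand.
rewrite fin_num_abs; apply: le_lt_trans Foo.
by apply: (@le_abse_intRn_aux R n); exact/measurable_EFinP.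
Qed.

(** At a fixed time lag [a > 0] the integrand is absolutely integrable, so dominated convergence
    along sequences makes the principal value an ordinary integral. *)
Lemma lim_intRn_integrand : (intRn (fun y => `|F y|%:E) < +oo)%E ->
  lim ((fun delta : R => intRn (fun y => ((W - u y) / a `^ P
      * expR (- (enorm (psub c y) ^+ 2) / (4 * a))
      * \1_[set z : pt R n | delta < enorm (psub c z)] y)%:E)) @ (0 : R)^'+) =
  intRn (fun y => (F y)%:E).
Proof.
move=> Foo; apply: cvg_lim => //.
have [r Er] := intRn_integrand_fin_num Foo; rewrite Er.
have mF := measurable_integrand.
have mFd d : measurable_fun setT
    (fun y : mpt R n => F y * \1_[set z : pt R n | d < enorm (psub c z)] y).
  by apply: measurable_funM => //; apply: measurable_indic; exact: measurable_punctured.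
have FE d : (fun y => ((W - u y) / a `^ P
      * expR (- (enorm (psub c y) ^+ 2) / (4 * a))
      * \1_[set z : pt R n | d < enorm (psub c z)] y)%:E) =
    (fun y => (F y * \1_[set z : pt R n | d < enorm (psub c z)] y)%:E).
  by apply/funext => y; rewrite gprod0E /F /ka [_ / _]mulrC.
under eq_fun do rewrite FE.
apply/cvge_at_rightP => v [v0 vcvg].
rewrite -Er -(intRn_punctured c n0 mF).
apply: (@intRn_aux_dominated R n _ _ (fun y => `|F y|%:E)).
- by move=> m; exact/measurable_EFinP.
- exact/measurable_EFinP.
- by apply/measurable_EFinP; exact: measurableT_comp.
- move=> y; have [e0|e0] := ltP 0 (enorm (psub c y)).
    apply: cvg_near_cst; move/cvgrPdist_lt: vcvg => /(_ _ e0).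
    apply: filterS => m; rewrite sub0r normrN gtr0_norm// => vm.
    by rewrite !indicE !mem_set.
  have h0 d : 0 <= d -> \1_[set z : pt R n | d < enorm (psub c z)] y = 0 :> R.
    move=> d0; rewrite indicE memNset//= => h.
    by have := lt_le_trans h e0; rewrite ltNge d0.
  by apply: cvg_near_cst; apply: nearW => m; rewrite !h0// ltW.
- move=> m y; rewrite /= lee_fin normrM -[leRHS]mulr1 ler_wpM2l//.
  by rewrite indicE; case: (_ \in _); rewrite ?normr1 ?normr0.
- exact: Foo.
Qed.

End inner_integral.

(** * Absolute integrability on almost every time slice *)

Lemma measurable_fun_powR d (T : measurableType d) (R : realType) (f : T -> R) (p : R) :
  measurable_fun setT f -> measurable_fun setT (fun x => f x `^ p).
Proof. by move=> mf; exact: (measurableT_comp (measurable_powR p) mf). Qed.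

Section integrability.
Variables (R : realType) (n : nat) (s : R) (w : pt R n -> R -> R).
Local Notation mu := (@lebesgue_measure R).
Local Notation P := (n%:R / 2 + 1 + s).
Hypothesis mw : measurable_fun setT (fun p : mpt R n * measurableTypeR R => w p.1 p.2).

Lemma measurable_slice tau : measurable_fun setT (fun y : mpt R n => w y tau).
Proof.
have mp : measurable_fun setT (fun y : mpt R n => (y, tau : measurableTypeR R)).
  exact: measurable_fun_pair.
exact: (measurableT_comp mw mp).
Qed.

Lemma ae_intRn_weight_lty t : calL s w ->
  {ae mu, forall tau, tau < t ->
    (intRn (fun x => (`|w x tau| * expR (- (enorm x ^+ 2) / (4 * (t - tau))))%:E)
      < +oo)%E}.
Proof.
move=> [_ /(_ t)].
(* Inverses are written as powers of exponent -1, for joint measurability; they agree with the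
   quotients for [tau < t]. *)
pose g tau (x : mpt R n) := (`|w x tau| * expR (- (enorm x ^+ 2) * (4 * (t - tau)) `^ (-1))
  * (1 + (t - tau) `^ P) `^ (-1))%:E.
have mg : measurable_fun setT (fun p : measurableTypeR R * mpt R n => g p.1 p.2).
  apply/measurable_EFinP; apply: measurable_funM; first apply: measurable_funM.
  - apply: measurableT_comp => //.
    have msw : measurable_fun setT (fun p : measurableTypeR R * mpt R n => (p.2, p.1)).
      by apply: measurable_fun_pair; [exact: measurable_snd|exact: measurable_fst].
    exact: (measurableT_comp mw msw).
  - apply: measurableT_comp => //; apply: measurable_funM.
      apply: measurableT_comp => //.
      exact: (measurableT_comp (@measurable_sqr_enorm R n) measurable_snd).
    apply: measurable_fun_powR; apply: measurable_funM => //.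
    by apply: measurable_funB => //; exact: measurable_fst.
  - apply: measurable_fun_powR; apply: measurable_funD => //.
    apply: measurable_fun_powR.
    by apply: measurable_funB => //; exact: measurable_fst.
have g0 tau x : (0 <= g tau x)%E by rewrite lee_fin !mulr_ge0// ?expR_ge0 ?powR_ge0.
have gE tau : tau < t -> g tau = (fun x => (`|w x tau| *
    expR (- (enorm x ^+ 2) / (4 * (t - tau))) / (1 + (t - tau) `^ P))%:E).
  move=> tt; apply/funext => x; rewrite /g !powR_inv1//.
    by rewrite addr_ge0// powR_ge0.
  by rewrite mulr_ge0//; lra.
rewrite [X in (X < _)%E](_ : _ = \int[mu]_(tau in `]-oo, t[) intRn (g tau))%E; last first.
  by apply: eq_integral => tau /[!inE]/= /[!in_itv]/= tt; rewrite gE.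
move=> goo.
have mG : measurable_fun setT (fun tau : measurableTypeR R => intRn (g tau)).
  exact: (@measurable_intRn_aux R n _ (measurableTypeR R) g n (fun=> (fun=> 0)) mg).
have iG : mu.-integrable `]-oo, t[ (fun tau => intRn (g tau)).
  apply/integrableP; split; first exact: measurable_funTS.
  apply: le_lt_trans goo; rewrite le_eqVlt; apply/orP; left; apply/eqP.
  by apply: eq_integral => tau _; rewrite gee0_abs//; exact: intRn_aux_ge0.
have mI : measurable (`]-oo, t[%classic : set (measurableTypeR R)).
  exact: measurable_itv.
have := integrable_ae mI iG.
apply: (@filterS _ _ (ae_filter_ringOfSetsType mu)) => tau.
rewrite /= in_itv/= => h tt; move: (h tt).
rewrite ge0_fin_numE; last exact: intRn_aux_ge0.
have D0 : 0 < 1 + (t - tau) `^ P by rewrite ltr_wpDr ?powR_ge0.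
move=> goo'.
have mgt : measurable_fun setT (g tau).
  have mp : measurable_fun setT (fun y : mpt R n => (tau : measurableTypeR R, y)).
    exact: measurable_fun_pair.
  exact: (measurableT_comp mg mp).
rewrite (_ : (fun x => _) = (fun x => (1 + (t - tau) `^ P)%:E * g tau x)%E).
  rewrite /intRn (@intRn_auxZl R n)//; last exact: ltW.
  by rewrite lte_mul_pinfty// ?lee_fin ?ltW.
apply/funext => x; rewrite gE// -EFinM; congr (_%:E).
by field; rewrite gt_eqF//; lra.
Qed.

(** The weight of [calL] is centred at the origin. Used at the later time [t + 1] it is wide enough
    to dominate, up to a constant, the kernel centred at [c]. *)
Lemma ae_intRn_integrand_lty (c : pt R n) t W : calL s w ->
  {ae mu, forall tau, tau < t ->
    (intRn (fun y => `|((t - tau) `^ P)^-1 * (W - w y tau) * gprod c (t - tau) 0 y|%:E)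
      < +oo)%E}.
Proof.
move=> /(@ae_intRn_weight_lty (t + 1)).
apply: (@filterS _ _ (ae_filter_ringOfSetsType mu)) => tau h tt.
have a0 : 0 < t - tau by lra.
set a := t - tau in a0 *; set k := (a `^ P)^-1.
have k0 : 0 <= k by rewrite invr_ge0 powR_ge0.
have {h} := h ltac:(lra); rewrite (_ : t + 1 - tau = a + 1); last by rewrite /a; ring.
set v := (fun x => _) => voo.
pose C := expR (enorm c ^+ 2 / 4).
(* Completing the square in each coordinate: the difference of exponents is [(y i - c i - a * c i)
   ^+ 2 / (4 * a * (a + 1))]. *)
have Kle y : gprod c a 0 y <= C * expR (- (enorm y ^+ 2) / (4 * (a + 1))).
  rewrite -gprod0E /C -expRD ler_expR !mulNr -subr_ge0 !sqr_enorm !mulr_suml.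
  rewrite opprK -sumrB -big_split/=; apply: sumr_ge0 => i _.
  rewrite /psub (_ : _ + _ = (y i - c i - a * c i) ^+ 2 / (4 * a * (a + 1))).
    by rewrite divr_ge0 ?sqr_ge0// !mulr_ge0//; lra.
  by field; rewrite !gt_eqF//; lra.
pose K (y : mpt R n) := (gprod c a 0 y)%:E.
have mK : measurable_fun setT K by apply/measurable_EFinP; exact: measurable_gprod.
have K0 y : (0 <= K y)%E by rewrite lee_fin ltW// gprod_gt0.
have mv : measurable_fun setT (v : mpt R n -> \bar R).
  apply/measurable_EFinP; apply: measurable_funM.
    by apply: measurableT_comp => //; exact: measurable_slice.
  apply: measurableT_comp => //; apply: measurable_funM => //.
  by apply: measurableT_comp => //; exact: measurable_sqr_enorm.
have v0 y : (0 <= v y)%E by rewrite lee_fin mulr_ge0// expR_ge0.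
have C0 : 0 <= C by exact: expR_ge0.
apply: (@le_lt_trans _ _ (intRn (fun y => (k * `|W|)%:E * K y + (k * C)%:E * v y)%E)).
  apply: (@le_intRn_aux R n) => y; first by rewrite lee_fin.
  rewrite -!EFinM -EFinD lee_fin !normrM (ger0_norm k0).
  rewrite (ger0_norm (ltW (gprod_gt0 _ _ _ _))) -!mulrA -mulrDr ler_wpM2l//.
  apply: (@le_trans _ _ ((`|W| + `|w y tau|) * gprod c a 0 y)).
    by rewrite ler_wpM2r ?(ltW (gprod_gt0 _ _ _ _))// ler_normB.
  by rewrite mulrDl lerD2l mulrCA ler_wpM2l.
rewrite /intRn (@intRn_auxD R n).
- rewrite !(@intRn_auxZl R n)// ?mulr_ge0//.
  rewrite intRn_aux_gprod//; apply: lte_add_pinfty; first by rewrite -EFinM ltry.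
  by rewrite lte_mul_pinfty// ?lee_fin ?mulr_ge0.
- exact: measurable_funeM.
- exact: measurable_funeM.
- by move=> y; rewrite mule_ge0// lee_fin mulr_ge0.
- by move=> y; rewrite mule_ge0// lee_fin mulr_ge0.
Qed.

End integrability.

(** * Integration in time *)

Section time_integral.
Variables (R : realType) (s r C K : R).
Hypotheses (s1 : s < 1) (r0 : 0 < r) (C0 : 0 <= C).
Local Notation mu := (@lebesgue_measure R).

(** Profiles in the time lag [a]: a loss for [a <= r], a gain on []r, 2 * r]], and nothing beyond.
    They are used with [r = rho ^+ 2]. *)
Definition time_loss (a : R) : R := ((fun z => z `^ (- s)) \_ `]0, r]) a.
Definition time_gain (a : R) : R := \1_`]r, 2 * r] a.

Lemma integral_time_gt0 t (f : R -> \bar R) :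
  C * (r `^ (1 - s) / (1 - s)) < K * r ->
  {ae mu, forall tau, tau < t ->
    ((K * time_gain (t - tau) - C * time_loss (t - tau))%:E <= f tau)%E} ->
  (0 < \int[mu]_(tau in `]-oo, t[) f tau)%E.
Proof.
move=> CK hf; have r0' := r0.
have ml : measurable_fun setT time_loss.
  apply/(measurable_restrictT _ _).1 => //; apply: measurable_funTS.
  exact: measurable_powR.
have mg : measurable_fun setT time_gain by exact: measurable_indic.
have ml0 z : 0 <= time_loss z.
  by rewrite /time_loss patchE; case: ifP => // _; exact: powR_ge0.
pose G z := (K * time_gain z - C * time_loss z)%:E.
have mG : measurable_fun setT G.
  apply/measurable_EFinP; apply: measurable_funB; exact: measurable_funM.
have intl : (\int[mu]_z (time_loss z)%:E <= (r `^ (1 - s) / (1 - s))%:E)%E.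
  apply: le_trans (integral_powR_le s1 r0); rewrite [leRHS]integral_mkcond.
  rewrite le_eqVlt; apply/orP; left; apply/eqP; apply: eq_integral => z _.
  by rewrite /time_loss !patchE; case: ifP.
have il0 : mu.-integrable setT (fun z => (time_loss z)%:E).
  apply/integrableP; split; first exact/measurable_EFinP.
  under eq_integral do rewrite gee0_abs ?lee_fin//.
  exact: le_lt_trans intl (ltry _).
have il : mu.-integrable setT (fun z => C%:E * (time_loss z)%:E)%E.
  exact: integrableZl.
have Eg : (\int[mu]_z (time_gain z)%:E = r%:E)%E.
  rewrite integral_indic//= setIT lebesgue_measure_itv/= lte_fin ifT; last lra.
  by rewrite -EFinB; congr (_%:E); ring.
have ig0 : mu.-integrable setT (fun z => (time_gain z)%:E).
  apply/integrableP; split; first exact/measurable_EFinP.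
  under eq_integral do rewrite gee0_abs ?lee_fin//.
  by rewrite Eg ltry.
have ig : mu.-integrable setT (fun z => K%:E * (time_gain z)%:E)%E.
  exact: integrableZl.
apply: (@lt_le_trans _ _ (\int[mu]_z G z)%E).
  rewrite (_ : (\int[mu]_z G z)%E =
      (\int[mu]_z ((fun z => K%:E * (time_gain z)%:E) \-
                   (fun z => C%:E * (time_loss z)%:E)) z)%E); last first.
    by apply: eq_integral => z _; rewrite /G EFinB !EFinM.
  rewrite integralB// !integralZl// Eg -EFinM.
  apply: (@lt_le_trans _ _ ((K * r)%:E - (C * (r `^ (1 - s) / (1 - s)))%:E)%E).
    by rewrite -EFinB lte_fin subr_gt0.
  by apply: leeB => //; rewrite EFinM lee_wpmul2l// lee_fin.
rewrite -(integral_reflect t mG) [leRHS]integral_mkcond.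
apply: ae_le_integral.
  exact: (measurableT_comp mG (measurable_fun_reflect t)).
apply: (@filterS _ _ (ae_filter_ringOfSetsType mu) _ _ _ hf) => tau h.
rewrite patchE; case: ifPn => [/set_mem/=|/negP ht]; rewrite ?in_itv/=.
  exact: h.
have tt : t <= tau.
  by rewrite leNgt; apply/negP => tt; apply: ht; rewrite inE/= in_itv.
rewrite /G /time_gain /time_loss indicE patchE !memNset ?mulr0 ?subrr//=.
- by rewrite in_itv/= => /andP[]; lra.
- by rewrite in_itv/= => /andP[]; lra.
Qed.

End time_integral.

(** The Gaussian mass cancels the dimensional part of the power of [a]. *)
Lemma kernel_mass (R : realType) (n : nat) (s a : R) : 0 < a ->
  (a `^ (n%:R / 2 + 1 + s))^-1 * Num.sqrt (4 * pi * a) ^+ n =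
  (4 * pi) `^ (n%:R / 2) * a `^ (- (1 + s)).
Proof.
move=> a0; have p0 : 0 <= 4 * pi :> R by rewrite mulr_ge0// pi_ge0.
rewrite -powR12_sqrt ?mulr_ge0 ?pi_ge0 ?ltW// -powR_mulrn ?powR_ge0// -powRrM.
rewrite [2^-1 * _]mulrC powRM// ?ltW// mulrCA; congr (_ * _).
rewrite -powRN -powRD; last by rewrite (gt_eqF a0) implybT.
by congr (_ `^ _); ring.
Qed.

(** * Lower bounds at the maximum point for small and large time lags *)

Section lower_bound_at_maximum.
Variables (R : realType) (n : nat) (s l : R) (w : pt R n -> R -> R).
Hypotheses (n0 : (0 < n)%N).
Local Notation i0 := (Ordinal n0).
Local Notation cn := ((4 * pi) `^ (n%:R / 2) : R).
Local Notation P := (n%:R / 2 + 1 + s).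
Hypothesis odd : forall x t, Sigma l x -> w x t = - w (refl l x) t.
Variables (x0 xb : pt R n) (t0 tb rho eps : R).
Local Notation W := (w xb tb).
Hypotheses (rho0 : 0 < rho) (eps0 : 0 < eps) (xbl : Sigma l xb).
Hypothesis b0 : 0 < bump x0 t0 rho xb tb.
Hypothesis Weps : 0 <= 2 * W - 2 * eps.
Hypothesis wmax : forall y tau, Sigma l y ->
  eps * (bump x0 t0 rho y tau - bump x0 t0 rho xb tb) <= W - w y tau /\
  - eps <= W - w y tau.
Variable tau : R.
Hypothesis taut : tau < tb.
Local Notation a := (tb - tau).
Hypothesis mwt : measurable_fun setT (fun y : mpt R n => w y tau).
Let F (y : mpt R n) := (a `^ P)^-1 * (W - w y tau) * gprod xb a 0 y.
Hypothesis Foo : (intRn (fun y => `|F y|%:E) < +oo)%E.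

(** The barrier is the bump difference, and the tail is discarded with [p = 0]. The loss is of order
    [a], which turns the power [- (1 + s)] into the integrable [- s]. *)
Lemma intRn_lower_small : a <= rho ^+ 2 ->
  ((- (cn * eps * (16 * n%:R + 3) / rho ^+ 2) * a `^ (- s))%:E <=
    intRn (fun y => (F y)%:E))%E.
Proof.
move=> ar; have a0 : 0 < a by rewrite subr_gt0.
have mF : measurable_fun setT F by exact: measurable_integrand.
have r2 : 0 < rho ^+ 2 by rewrite exprn_gt0.
(* Coefficients of the expansion of [eps] times the bump difference around [xb]; [al] is the change
   due to time. *)
pose ga := eps / rho ^+ 2.
pose be i := - (2 * eps * (xb i - x0 i) / rho ^+ 2).
pose al := eps * (2 * (tb - t0) * a - a ^+ 2) / rho ^+ 4.
have ga0 : 0 <= ga by rewrite divr_ge0// ltW.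
have ka0 : 0 <= (a `^ P)^-1 by rewrite invr_ge0 powR_ge0.
have hE y : al + hsum xb be ga 0 y =
    eps * (bump x0 t0 rho y tau - bump x0 t0 rho xb tb).
  have -> : hsum xb be ga 0 y =
      - (eps / rho ^+ 2) * (\sum_i (y i - x0 i) ^+ 2 - \sum_i (xb i - x0 i) ^+ 2).
    rewrite /hsum -sumrB mulr_sumr; apply: eq_bigr => i _; rewrite /be /ga.
    by field; rewrite gt_eqF.
  rewrite /al /bump; field; rewrite gt_eqF//.
have tail : ((0 * Num.sqrt (4 * pi * a))%:E <=
    \int[@lebesgue_measure R]_z (\1_`]l, +oo[ z * gauss (xb i0) a z)%:E)%E.
  rewrite mul0r; apply: integral_ge0 => z _.
  by rewrite lee_fin; apply: mulr_ge0 => //; exact/ltW/gauss_gt0.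
have := @intRn_aux_lower R n xb a a0 be ga ga0 l W eps al ((a `^ P)^-1) 0
  (fun y => w y tau) F n0 ka0 Weps xbl _ _ _ (fun y => erefl) mF tail n.-1 (fun=> 0).
rewrite prednK// gprod_n hsum_n mulr0 !addr0 mulr1 => lower.
apply: le_trans (lower _ _ _ _ Foo); last 4 first.
- by move=> y Sy; rewrite [w y tau]odd// opprK.
- by move=> y Sy; rewrite hE; have [] := wmax tau Sy.
- move=> y; rewrite hE -[leRHS]mulr1 ler_pM2l//.
  by have := bump_le1 x0 t0 rho0 y tau; have := b0; lra.
- exact: leqnn.
rewrite lee_fin kernel_mass//.
have aE : a `^ (- s) = a * a `^ (- (1 + s)).
  rewrite -[X in X * _]powRr1; last exact: ltW.
  by rewrite -powRD; [congr (_ `^ _); ring|rewrite (gt_eqF a0) implybT].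
rewrite aE.
have e1 : 0 < a `^ (- (1 + s)) by rewrite powR_gt0.
have c1 : 0 <= cn by rewrite powR_ge0.
suff h : - (eps * (16 * n%:R + 3) / rho ^+ 2) * a <= al - n%:R * ga * (16 * a).
  rewrite (_ : - _ * _ = cn * a `^ (- (1 + s)) *
    (- (eps * (16 * n%:R + 3) / rho ^+ 2) * a)); last by ring.
  by rewrite ler_wpM2l// mulr_ge0// ltW.
have [_ tt] := bump_ge0 rho0 (ltW b0).
(* The second moments cost [16 * n]. Since [tb - t0 >= - rho ^+ 2] and [a <= rho ^+ 2], the term
   [al] costs at most 3. *)
rewrite -subr_ge0 (_ : _ - _ = eps * a / rho ^+ 4 *
  (2 * (tb - t0 + rho ^+ 2) + (rho ^+ 2 - a))); last first.
  by rewrite /al /ga; field; rewrite gt_eqF.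
rewrite mulr_ge0//.
  by rewrite divr_ge0 ?mulr_ge0 ?exprn_ge0// ltW.
by move: tt; rewrite ler_norml => /andP[]; lra.
Qed.

(** The barrier is the constant [- eps]. Here [l - xb i0 <= 3 * rho <= 3 * Num.sqrt a], so at least
    a fraction [p] of the Gaussian mass lies beyond the hyperplane. *)
Lemma intRn_lower_large p : p * Num.sqrt (4 * pi) <= expR (- 4) ->
  l - xb i0 <= 3 * rho -> rho ^+ 2 <= a ->
  ((cn * a `^ (- (1 + s)) * (- eps + (2 * W - 2 * eps) * p))%:E <=
    intRn (fun y => (F y)%:E))%E.
Proof.
move=> hp lxb ra; have a0 : 0 < a by rewrite subr_gt0.
have mF : measurable_fun setT F by exact: measurable_integrand.
have ka0 : 0 <= (a `^ P)^-1 by rewrite invr_ge0 powR_ge0.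
have hs y : hsum xb (fun=> 0) 0 0 y = 0 by rewrite /hsum big1// => i _; ring.
have tail : ((p * Num.sqrt (4 * pi * a))%:E <=
    \int[@lebesgue_measure R]_z (\1_`]l, +oo[ z * gauss (xb i0) a z)%:E)%E.
  apply: le_trans (gauss_tail_ge a0 _).
    rewrite lee_fin sqrtrM ?mulr_ge0 ?pi_ge0// mulrA.
    by rewrite ler_wpM2r// sqrtr_ge0.
  apply: le_trans lxb _; rewrite ler_pM2l// -[leLHS]gtr0_norm// -sqrtr_sqr.
  exact: ler_wsqrtr.
have := @intRn_aux_lower R n xb a a0 (fun=> 0) 0 (lexx 0) l W eps (- eps) ((a `^ P)^-1) p
  (fun y => w y tau) F n0 ka0 Weps xbl _ _ _ (fun y => erefl) mF tail n.-1 (fun=> 0).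
rewrite prednK// gprod_n hsum_n !mulr0 mul0r subr0 addr0 mulr1 => lower.
apply: le_trans (lower _ _ _ _ Foo); last 4 first.
- by move=> y Sy; rewrite [w y tau]odd// opprK.
- by move=> y Sy; rewrite hs addr0; have [] := wmax tau Sy.
- by move=> y; rewrite hs addr0; have := eps0; lra.
- exact: leqnn.
by rewrite kernel_mass.
Qed.

End lower_bound_at_maximum.

(** * Choice of the constants and the final contradiction *)

Unset Implicit Arguments.

Theorem theorem1p3 (R : realType) (n : nat) (s l : R) (w : pt R n -> R -> R) :
  (1 <= n)%N -> 0 < s < 1 ->
  (* w in C^{2s+eps, s+eps}_{x,t,loc}(Sigma_l x R) for some eps > 0 *)
  (exists eps : R, 0 < eps /\
     HolderLocSpace (s + eps) (fun x t => Sigma l x) w) ->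
  (* w in L(R^n x R) *)
  calL s w ->
  (* upper semi-continuous up to the boundary T_l *)
  (forall x0 t0, SigmaBar l x0 -> forall e : R, 0 < e -> exists d : R, 0 < d /\
     forall x t, SigmaBar l x -> pdist x t x0 t0 < d -> w x t < w x0 t0 + e) ->
  (* bounded from above in Sigma_l x R *)
  (exists M : R, forall x t, Sigma l x -> w x t <= M) ->
  (forall x t, Sigma l x -> 0 < w x t -> (fracHeat s w x t <= 0)%E) ->
  (forall x t, Sigma l x -> w x t = - w (refl l x) t) ->
  forall x t, Sigma l x -> w x t <= 0.
Proof.
move=> n0 s01 _ cw usc [M wM] heat odd.
have /andP[s0 s1] := s01.
have mw := measurable_antisymmetric_usc n0 usc odd.
apply: contrapT => /existsNP[x1 /existsNP[t1 /not_implyP[Sx1 /negP]]].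
rewrite -ltNge => w1.
pose i0 := Ordinal n0.
pose V := [set v : R | exists x t, Sigma l x /\ v = w x t].
have V0 : V !=set0 by exists (w x1 t1), x1, t1.
have Vub : has_ubound V by exists M => _ [x [t [Sx ->]]]; exact: wM.
pose A := sup V.
have wA x t : Sigma l x -> w x t <= A.
  by move=> Sx; apply: ub_le_sup => //; exists x, t.
have A0 : 0 < A by exact: lt_le_trans w1 (wA _ _ Sx1).
(* The fraction of mass granted by [gauss_tail_ge]. *)
pose p0 : R := expR (- 4) / Num.sqrt (4 * pi).
have pi1 : 1 <= Num.sqrt (4 * pi) :> R.
  by rewrite -[leLHS]sqrtr1; apply: ler_wsqrtr; have := pi_ge2 R; lra.
have p00 : 0 < p0 by rewrite divr_gt0 ?expR_gt0//; lra.
have p01 : p0 <= 1.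
  rewrite ler_pdivrMr; last by lra.
  by rewrite mul1r; apply: le_trans pi1; rewrite -[leRHS]expR0 ler_expR; lra.
have hp : p0 * Num.sqrt (4 * pi) <= expR (- 4).
  by rewrite divfK// gt_eqF//; lra.
pose N : R := 16 * n%:R + 3.
have N3 : 3 <= N by rewrite /N lerDr mulr_ge0.
(* Chosen so that the normalised loss [eps * N / (1 - s)] equals [A * p0 / 16], half of the lower
   bound [A * p0 / 8] for the gain. *)
pose eps := A * p0 * (1 - s) / (16 * N).
have N0 : 0 < 16 * N by lra.
have Ap0 : 0 < A * p0 by rewrite mulr_gt0.
have epsE : eps * N / (1 - s) = A * p0 / 16.
  by rewrite /eps; field; apply/andP; split; rewrite gt_eqF//; lra.
have eps0 : 0 < eps by rewrite divr_gt0// mulr_gt0//; lra.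
have eps5 : eps <= A * p0 / 5.
  rewrite ler_pdivrMr//.
  have : A * p0 * (1 - s) <= A * p0 * 1 by rewrite ler_wpM2l//; lra.
  have : A * p0 * 9 <= A * p0 * (3 * N) by rewrite ler_wpM2l//; lra.
  by lra.
have eps5A : 5 * eps <= A.
  have : A * p0 <= A * 1 by rewrite ler_pM2l.
  by lra.
have [x0 [t0 [Sx0 w0]]] : exists x0 t0, Sigma l x0 /\ A - eps < w x0 t0.
  have [_ [x [t [Sx ->]]] h] := sup_adherent eps0 (conj V0 Vub).
  by exists x, t.
pose rho := (l - x0 i0) / 2.
have x0l : x0 i0 < l by exact: Sx0.
have rho0 : 0 < rho by rewrite /rho; lra.
have x0rho : x0 i0 + rho < l by rewrite /rho; lra.
have [xb [tb [Sxb b0 wb wmax]]] :=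
  perturbed_maximum rho0 (erefl : val i0 = 0%N) usc wA x0rho eps0 w0.
have [xb0 _] := bump_ge0 rho0 (ltW b0).
(* The centre is at distance [2 * rho] from the hyperplane, and [xb] moves its first coordinate by
   at most [rho]. *)
have lxb : l - xb i0 <= 3 * rho.
  by have := xb0 i0; rewrite ler_norml /rho => /andP[]; lra.
have Wpos : 0 < w xb tb by lra.
have Weps : 0 <= 2 * w xb tb - 2 * eps by lra.
have := heat xb tb Sxb Wpos; rewrite leNgt => /negP; apply.
rewrite /fracHeat mule_gt0// ?lte_fin ?Cns_gt0//.
pose r := rho ^+ 2; have r0 : 0 < r by rewrite exprn_gt0.
pose cn : R := (4 * pi) `^ (n%:R / 2).
have cn0 : 0 < cn by rewrite powR_gt0// mulr_gt0// pi_gt0.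
pose C := cn * eps * N / r.
pose K := cn * (2 * r) `^ (- (1 + s)) * (A * p0 / 2).
have N1 : 0 < N by lra.
have C0 : 0 <= C.
  by apply: ltW; apply: divr_gt0 => //; apply: mulr_gt0 => //; exact: mulr_gt0.
apply: (@integral_time_gt0 R s r C K s1 r0 C0).
  have rs0 : 0 < r `^ (- s) by rewrite powR_gt0.
  have rE1 : r `^ (1 - s) = r * r `^ (- s).
    rewrite -[X in X * _]powRr1 ?ltW// -powRD//.
    by rewrite (gt_eqF r0) implybT.
  have rE2 : (2 * r) `^ (- (1 + s)) * r = 2 `^ (- (1 + s)) * r `^ (- s).
    rewrite powRM ?ltW// -mulrA; congr (_ * _).
    rewrite -[X in _ * X]powRr1 ?ltW// -powRD; last by rewrite (gt_eqF r0) implybT.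
    by congr (_ `^ _); ring.
  have two : 4^-1 <= 2 `^ (- (1 + s)) :> R.
    have -> : 4^-1 = 2 `^ (- 2%:R) :> R.
      by rewrite powR_invn//; congr (_^-1); ring.
    by rewrite ler_powR//; lra.
  have -> : C * (r `^ (1 - s) / (1 - s)) = cn * r `^ (- s) * (eps * N / (1 - s)).
    rewrite rE1 /C; field; apply/andP; split; rewrite gt_eqF//; lra.
  have -> : K * r = cn * r `^ (- s) * (2 `^ (- (1 + s)) * (A * p0 / 2)).
    by rewrite /K mulrAC -[cn * _ * r]mulrA rE2; ring.
  (* Both sides scale like [cn * r]^ (- s)[. What remains follows from]2 [^ (- (1 + s)) >= 4^-1]. *)
  rewrite ltr_pM2l ?mulr_gt0// epsE.
  have : 4^-1 * (A * p0 / 2) <= 2 `^ (- (1 + s)) * (A * p0 / 2).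
    by rewrite ler_wpM2r//; lra.
  by lra.
have := @ae_intRn_integrand_lty R n s w mw xb tb (w xb tb) cw.
apply: (@filterS _ _ (ae_filter_ringOfSetsType (@lebesgue_measure R))) => tau h tt.
have Foo := h tt; have a0 : 0 < tb - tau by lra.
have mwt := measurable_slice mw tau.
rewrite (lim_intRn_integrand n0 mwt Foo).
have [ar|ra] := leP (tb - tau) r.
  apply: le_trans (intRn_lower_small n0 odd rho0 eps0 Sxb b0 Weps wmax tt mwt Foo ar).
  rewrite lee_fin /time_gain /time_loss indicE memNset/= ?patchE; last first.
    by rewrite in_itv/= => /andP[]; lra.
  rewrite mem_set/=; last by rewrite in_itv/= a0.
  by rewrite mulr0 sub0r -mulNr.
have rae := ltW ra.
apply: le_trans (intRn_lower_large odd rho0 eps0 Sxb Weps wmax tt mwt Foo hp lxb rae).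
rewrite lee_fin /time_loss patchE memNset/=; last first.
  by rewrite in_itv/= => /andP[]; lra.
rewrite mulr0 subr0 /time_gain indicE.
(* Follows from [A - eps < w xb tb], [p0 <= 1] and [5 * eps <= A * p0]. *)
have gain : A * p0 / 2 <= - eps + (2 * w xb tb - 2 * eps) * p0.
  have : (2 * A - 4 * eps) * p0 <= (2 * w xb tb - 2 * eps) * p0.
    by rewrite ler_wpM2r ?ltW//; lra.
  have : eps * p0 <= eps * 1 by rewrite ler_pM2l.
  by lra.
have e0 : 0 <= (tb - tau) `^ (- (1 + s)) by rewrite powR_ge0.
(* For lags beyond [2 * r] only the sign of the bound is kept. *)
have [/set_mem/=|_] := boolP (_ \in _); last first.
  by rewrite mulr0; apply: mulr_ge0; [rewrite mulr_ge0// ltW|lra].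
rewrite in_itv/= => /andP[_ a2r].
rewrite mulr1 /K -[leLHS]mulrA -[leRHS]mulrA ler_pM2l//.
apply: ler_pM => //; [exact: powR_ge0|by lra|].
by apply: powRN_le; lra.
Qed.
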